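(* Let $M\in\mathbb{N}$, $\mathcal{I}=\{1,\dots,M\}$, and let $f_1,\dots,f_M:\mathbb{R}^n\to\mathbb{R}^n$ be locally Lipschitz vector fields with $f_i(0)=0$ such that each $\dot x=f_i(x)$ has unique solutions defined for all $t\in\mathbb{R}$, with flow $\Phi_i:\mathbb{R}\times\mathbb{R}^n\to\mathbb{R}^n$. Let $\tau_2\ge\tau_1\ge 0$. The switched system $\dot x(t)=f_{\sigma(t)}(x(t))$ is GUAS on $\mathcal{S}^\star_{\mathrm{dw}}(\tau_1,\tau_2)$ (and thus on $\mathcal{S}_{\mathrm{dw}}(\tau_1,\tau_2)$) if and only if there exist $\alpha_1,\alpha_2\in\mathcal{K}_\infty$ and continuous functions $W_i^-,W_i^+:\mathbb{R}^n\to\mathbb{R}$, for $i\in\mathcal{I}$, such that $$\alpha_1(|x|)\le W_i^{*}(x)\le\alpha_2(|x|)\quad\forall i\in\mathcal{I},\ \forall *\in\{-,+\},\ \forall x\in\mathbb{R}^n,$$ $$W_i^+(\Phi_i(\tau_1,x))\le e^{-\tau_1}W_i^-(x)\quad\forall i\in\mathcal{I},\ \forall x\in\mathbb{R}^n,$$ $$W_j^-(\Phi_i(t,x))\le e^{-t}W_i^+(x)\quad\forall i,j\in\mathcal{I}\text{ with }i\ne j,\ \forall t\in[0,\tau_2-\tau_1],\ \forall x\in\mathbb{R}^n.$$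
   Context: $\mathbb{R}_+=[0,\infty)$. A function $\alpha:\mathbb{R}_+\to\mathbb{R}$ is of class $\mathcal{K}$ if it is continuous, strictly increasing and $\alpha(0)=0$; it is of class $\mathcal{K}_\infty$ if in addition it is unbounded. A continuous $\beta:\mathbb{R}_+\times\mathbb{R}_+\to\mathbb{R}_+$ is of class $\mathcal{KL}$ if $\beta(\cdot,s)\in\mathcal{K}$ for every $s$, and for every $r$ the function $\beta(r,\cdot)$ is decreasing with $\beta(r,s)\to 0$ as $s\to\infty$. $\Phi_i(t,x)$ is the value at time $t$ of the solution of $\dot x=f_i(x)$ starting at $x$ at time $0$. $\mathcal{S}$ is the set of piecewise constant, right-continuous signals $\sigma:\mathbb{R}_+\to\mathcal{I}$. For $\sigma\in\mathcal{S}$, set $t_0^\sigma=0$ and let $t_1^\sigma<t_2^\sigma<\cdots$ be the positive times at which $\sigma$ is discontinuous (switching instants); if there are infinitely many, they are unbounded. For $x\in\mathbb{R}^n$, $\Phi_\sigma(t,x)$ denotes the solution at time $t\ge0$ of $\dot x(t)=f_{\sigma(t)}(x(t))$ with initial condition $x$ at time $0$. For $\tau_2\ge\tau_1\ge0$: $\mathcal{S}_{\mathrm{dw}}(\tau_1,\tau_2)$ is the set of $\sigma\in\mathcal{S}$ having infinitely many switching instants and satisfying $\tau_1\le t_k^\sigma-t_{k-1}^\sigma\le\tau_2$ for all $k\ge1$. $\mathcal{S}^\star_{\mathrm{dw}}(\tau_1,\tau_2)$ is the set of $\sigma\in\mathcal{S}$ having infinitely many switching instants and satisfying $t_1^\sigma\le\tau_2$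 and $\tau_1\le t_{k+1}^\sigma-t_k^\sigma\le\tau_2$ for all $k\ge1$. For $\widetilde{\mathcal{S}}\subseteq\mathcal{S}$, the switched system is globally uniformly asymptotically stable (GUAS) on $\widetilde{\mathcal{S}}$ if there is $\beta\in\mathcal{KL}$ such that $|\Phi_\sigma(t,x)|\le\beta(|x|,t)$ for all $\sigma\in\widetilde{\mathcal{S}}$, $x\in\mathbb{R}^n$, $t\in\mathbb{R}_+$. *)

(* Defs.v *)
From mathcomp Require Import all_boot all_order all_algebra.
From mathcomp Require Import all_classical all_reals all_analysis.

Set Implicit Arguments.
Unset Strict Implicit.
Unset Printing Implicit Defensive.

Import Order.TTheory GRing.Theory Num.Theory.
Import numFieldNormedType.Exports.

Local Open Scope classical_set_scope.
Local Open Scope ring_scope.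

(* Functions and signals whose domain is [0, +oo[ are encoded as functions on
   all of R; only their values on [0, +oo[ are ever constrained or used. *)

Section ComparisonFunctions.
Variable R : realType.

Definition class_K (a : R -> R) : Prop :=
  [/\ {within `[0, +oo[, continuous a},
      forall r s : R, 0 <= r -> r < s -> a r < a s
    & a 0 = 0].

Definition class_Kinfty (a : R -> R) : Prop :=
  class_K a /\ forall A : R, exists2 r : R, 0 <= r & A < a r.

(* Monotonicity in the second argument is not strict, since b 0 s = 0. *)
Definition class_KL (b : R -> R -> R) : Prop :=
  [/\ {within [set p : R * R | 0 <= p.1 /\ 0 <= p.2],
         continuous (fun p => b p.1 p.2)},
      forall r s : R, 0 <= r -> 0 <= s -> 0 <= b r s,
      forall s : R, 0 <= s -> class_K (b ^~ s),
      forall r s t : R, 0 <= r -> 0 <= s -> s <= t -> b r t <= b r s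
    & forall r : R, 0 <= r -> b r s @[s --> +oo] --> (0 : R)].

End ComparisonFunctions.

Section VectorFields.
Variables (R : realType) (n : nat).

(* The library norm on 'rV[R]_n is the sup norm. *)
Definition enorm (x : 'rV[R]_n) : R := Num.sqrt (\sum_(i < n) x ord0 i ^+ 2).

Definition locally_lipschitz (f : 'rV[R]_n -> 'rV[R]_n) : Prop :=
  forall x : 'rV[R]_n, exists2 U : set 'rV[R]_n,
    nbhs x U & [lipschitz f y | y in U].

Definition is_global_solution (f : 'rV[R]_n -> 'rV[R]_n) (x : 'rV[R]_n)
    (phi : R -> 'rV[R]_n) : Prop :=
  phi 0 = x /\ forall t : R, is_derive t 1 phi (f (phi t)).

Definition is_flow (f : 'rV[R]_n -> 'rV[R]_n)
    (Phi : R -> 'rV[R]_n -> 'rV[R]_n) : Prop :=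
  forall x, is_global_solution f x (Phi ^~ x) /\
    forall phi, is_global_solution f x phi -> phi = Phi ^~ x.

End VectorFields.

Section SwitchedSystems.
Variables (R : realType) (n M : nat).

Definition switching_instant (sigma : R -> 'I_M) : set R :=
  [set t | 0 < t /\
     ~ {for t, continuous (sigma : R -> discrete_topology 'I_M)}].

Definition piecewise_constant (sigma : R -> 'I_M) : Prop :=
  forall T : R, 0 < T -> exists2 s : seq R, itv_partition 0 T s &
    forall k, (k < size s)%N -> exists i : 'I_M,
      forall t : R, nth 0 (0 :: s) k < t < nth 0 (0 :: s) k.+1 -> sigma t = i.

Definition right_continuous_signal (sigma : R -> 'I_M) : Prop :=
  forall t : R, 0 <= t ->
    (sigma s : discrete_topology 'I_M) @[s --> t^'+]
      --> (sigma t : discrete_topology 'I_M).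

Definition switching_signals : set (R -> 'I_M) :=
  [set sigma | piecewise_constant sigma /\ right_continuous_signal sigma].

(* Such an enumeration, which is unique, exists exactly when sigma has
   infinitely many switching instants. *)
Definition enumerates_switching (sigma : R -> 'I_M) (t : nat -> R) : Prop :=
  [/\ t 0%N = 0, (forall k, t k < t k.+1)
    & range (fun k => t k.+1) = switching_instant sigma].

Definition S_dw (tau1 tau2 : R) : set (R -> 'I_M) :=
  [set sigma | switching_signals sigma /\
     exists2 t, enumerates_switching sigma t &
       forall k, tau1 <= t k.+1 - t k <= tau2].

Definition S_dw_star (tau1 tau2 : R) : set (R -> 'I_M) :=
  [set sigma | switching_signals sigma /\
     exists2 t, enumerates_switching sigma t &
       t 1%N <= tau2 /\ forall k, tau1 <= t k.+2 - t k.+1 <= tau2].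

(* The derivative is two-sided, so the equation is only imposed at positive
   times that are not switching instants. *)
Definition is_switched_solution (f : 'I_M -> 'rV[R]_n -> 'rV[R]_n)
    (sigma : R -> 'I_M) (x : 'rV[R]_n) (phi : R -> 'rV[R]_n) : Prop :=
  [/\ phi 0 = x, {within `[0, +oo[, continuous phi}
    & forall t : R, 0 < t -> ~ switching_instant sigma t ->
        is_derive t 1 phi (f (sigma t) (phi t))].

(* The solution is selected by choice; the default value cst x is irrelevant
   whenever a solution exists. *)
Definition switched_flow (f : 'I_M -> 'rV[R]_n -> 'rV[R]_n)
    (sigma : R -> 'I_M) (t : R) (x : 'rV[R]_n) : 'rV[R]_n :=
  xget (cst x) (is_switched_solution f sigma x) t.

Definition GUAS (f : 'I_M -> 'rV[R]_n -> 'rV[R]_n)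
    (S : set (R -> 'I_M)) : Prop :=
  exists2 beta : R -> R -> R, class_KL beta &
    forall sigma, S sigma -> forall (x : 'rV[R]_n) (t : R), 0 <= t ->
      enorm (switched_flow f sigma t x) <= beta (enorm x) t.

End SwitchedSystems.

(* Main.v *)
Require Import Defs.
From mathcomp Require Import all_boot all_order all_algebra.
From mathcomp Require Import all_classical all_reals all_analysis.
From mathcomp Require Import ring lra.
Set Implicit Arguments.
Unset Strict Implicit.
Unset Printing Implicit Defensive.
Import Order.TTheory GRing.Theory Num.Theory.
Import numFieldNormedType.Exports.
Local Open Scope classical_set_scope.
Local Open Scope ring_scope.

(** Along a signal, a stay of duration [d >= tau1] in mode [i] followed by a
    switch to [j] consists of [tau1] units of time, over which [Wp i] at the end
    is at most [e ^ (- tau1)] times [Wm i] at the beginning, and of [d - tau1]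
    units, over which [Wm j] at the end is at most [e ^ (- (d - tau1))] times
    [Wp i] at the beginning. Hence [Wm], read at the switching instants in the
    mode being entered, decays like [e ^ (- t)]. The first stay and the time
    elapsed since the last switch last at most [tau2], during which the flows
    amplify norms by a fixed comparison function ([flow_growth]). Inverting
    [alpha1] yields a KL bound ([lyapunov_GUAS]).

    Conversely, a KL bound becomes exponential after a change of gauge
    ([class_KL_exponential]): there are K-infinity functions [a] and [a2] with
    [a (b r t) <= e ^ (- 2 t) * a2 r]. Let [Wm i x] be the supremum of
    [e ^ t * a |y|] over all states [y] reached from [x] after a time [t] by a
    signal that has just switched to [i], and let [Wp i x] be the same supremum
    over the signals that have already spent [tau1] in [i]. Concatenating
    signals gives the two decrease conditions ([lyapunov_converse]); the value at
    [t = 0] gives the lower bound, and the exponential estimate the upper one.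
    Since the gauge decays at rate 2 and the weight grows at rate 1 only, long
    times contribute uniformly little, whereas over bounded times the states
    depend on [x] in a Lipschitz way, uniformly in the signal, because stability
    keeps all trajectories in a ball. So the suprema are continuous
    ([weight_equicontinuous]).

    The supremum is taken over finite words of pairs (mode, duration) instead of
    signals. Words contain their own interruptions and prolongations, and they
    allow stays of zero duration, which occur at the boundary cases [t = 0] and
    [tau1 = 0]; the stability bound passes to such words in the limit
    ([word_bound]).

    The two descriptions meet in [switched_flowE]: along a signal, the switched
    flow is the composition of the flows of the successive modes. Stability is
    vacuous if there is only one mode or if [tau2 = 0], since no signal switches
    infinitely often then, and the functions are given directly. *)

(** * Comparison functions *)

Section ComparisonLemmas.
Variable R : realType.
Implicit Types (a g : R -> R) (P : R -> R -> Prop).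

Lemma class_K_homo a r s : class_K a -> 0 <= r -> r <= s -> a r <= a s.
Proof.
move=> [_ inc _] r0; rewrite le_eqVlt => /orP[/eqP-> //|rs].
exact/ltW/inc.
Qed.

Lemma class_K_ge0 a r : class_K a -> 0 <= r -> 0 <= a r.
Proof. by move=> Ka r0; case: (Ka) => _ _ <-; exact: class_K_homo. Qed.

Lemma class_K_gt0 a r : class_K a -> 0 < r -> 0 < a r.
Proof. by case=> _ inc a0 r0; rewrite -a0 inc. Qed.

(** Precomposing with [Num.max 0] turns continuity on the half-line into plain
    continuity, which composes without side conditions. *)
Lemma class_K_ext_continuous a :
  class_K a -> continuous (fun r : R => a (Num.max 0 r)).
Proof.
move=> [/subspace_continuousP ca _ _] x.
have m0 y : (`[0, +oo[%classic : set R) (Num.max 0 y).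
  by rewrite /= in_itv/= andbT le_max lexx.
apply: cvg_comp (ca _ (m0 x)) => U.
have cm : (fun y : R => Num.max 0 y) @ x --> Num.max 0 x.
  by apply: continuous_max; [exact: cvg_cst | exact: cvg_id].
move=> /cm hU; apply: (@filterS _ (nbhs x) _ _ _ _ hU) => y; exact.
Qed.

Lemma class_K_of_continuous a : continuous a ->
  (forall r s, 0 <= r -> r < s -> a r < a s) -> a 0 = 0 -> class_K a.
Proof. by move=> ca inc a0; split=> //; exact: continuous_subspaceT. Qed.

Lemma class_K_comp a g : class_K a -> class_K g -> class_K (a \o g).
Proof.
move=> Ka Kg; have [cg ig g0] := Kg; have [ca ia a0] := Ka; split.
- apply: (@subspace_eq_continuous _ _ _
    ((fun r : R => a (Num.max 0 r)) \o (fun r : R => g (Num.max 0 r)))).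
    move=> x; rewrite inE/= in_itv/= andbT => x0.
    by rewrite /= max_r// max_r// (class_K_ge0 Kg).
  apply: continuous_subspaceT => x.
  by apply: continuous_comp; exact: class_K_ext_continuous.
- by move=> r s r0 rs /=; apply: ia (ig _ _ r0 rs); exact: class_K_ge0.
- by rewrite /= g0.
Qed.

(** As a function of [r] this is a nondecreasing ramp from 0 at [v / 2] to 1 at
    [v], with slope [2 / v]. *)
Let cutoff (v r : R) := Num.max 0 (Num.min 1 (2 * r / v - 1)).

Let cutoffP v r (x := 2 * r / v - 1) :
  [\/ x <= 0 /\ cutoff v r = 0, 0 <= x <= 1 /\ cutoff v r = x | 1 <= x /\ cutoff v r = 1].
Proof.
rewrite /cutoff -/x; have [x0|x0] := leP x 0.
  by constructor 1; split=> //; rewrite max_l// ge_min x0 orbT.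
have [x1|x1] := leP x 1; last by constructor 3; rewrite max_r ?(ltW x1).
by constructor 2; rewrite max_r (ltW x0)// x1.
Qed.

Let cutoff_le1 v r : cutoff v r <= 1.
Proof. by rewrite /cutoff ge_max ler01 ge_min lexx. Qed.

Let cutoff_eq1 v r : 0 < v -> v <= r -> cutoff v r = 1.
Proof.
move=> v0 vr; have h : 2 <= 2 * r / v by rewrite ler_pdivlMr// ler_wpM2l.
by rewrite /cutoff; rewrite min_l ?max_r//; lra.
Qed.

Let cutoff_eq0 v r : 0 < v -> 2 * r <= v -> cutoff v r = 0.
Proof.
move=> v0 vr; have h : 2 * r / v <= 1 by rewrite ler_pdivrMr// mul1r.
by rewrite /cutoff max_l// ge_min; apply/orP; right; lra.
Qed.

Let cutoff_homo v r s : 0 < v -> r <= s -> cutoff v r <= cutoff v s.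
Proof.
move=> v0 rs; have h : 2 * r / v <= 2 * s / v by rewrite ler_pM2r ?invr_gt0// ler_pM2l.
by have [[]|[]|[]] := cutoffP v r; have [[]|[]|[]] := cutoffP v s; lra.
Qed.

Let cutoff_lip v r r0 : 0 < v -> 0 < r0 -> `|r - r0| < r0 / 2 ->
  `|cutoff v r - cutoff v r0| <= 4 / r0 * `|r - r0|.
Proof.
move=> v0 r00; rewrite ltr_norml => /andP[h1 h2].
have C0 : 0 <= 4 / r0 * `|r - r0| by rewrite mulr_ge0// divr_ge0//; lra.
have [vr|rv] := leP v (r0 / 2).
  by rewrite !cutoff_eq1 ?subrr ?normr0//; lra.
have h : `|2 * r / v - 2 * r0 / v| <= 4 / r0 * `|r - r0|.
  rewrite -mulrBl -mulrBr !normrM normfV (gtr0_norm v0) normr_nat mulrAC.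
  rewrite ler_wpM2r// ler_pdivlMr// mulrAC ler_pdivrMr//; lra.
move: h; rewrite !ler_norml => /andP[h3 h4].
by have [[]|[]|[]] := cutoffP v r; have [[]|[]|[]] := cutoffP v r0; lra.
Qed.

(** The majorant is [r] plus the supremum of [y * cutoff v r] over the pairs
    satisfying [P v y]. Each ramp is nondecreasing and equals 1 at [r = v], which
    gives monotonicity and the bound; near a positive [r0] only pairs with
    [v <= 4 r0] count, with bounded [y], and their ramps are uniformly Lipschitz
    there, which gives continuity; near 0 only small [v] count. *)
Lemma Kinfty_majorant P :
  (forall r, exists B, forall v y, 0 <= v <= r -> P v y -> y <= B) ->
  (forall e, 0 < e -> exists2 d, 0 < d &
     forall v y, 0 <= v <= d -> P v y -> y <= e) ->
  exists g, [/\ class_Kinfty g, forall r, 0 <= r -> r <= g r &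
    forall v y, 0 <= v -> P v y -> y <= g v].
Proof.
move=> bd lim0.
pose S r := [set z | z = 0 \/
  exists v y, [/\ 0 < v, 0 <= y, P v y & z = y * cutoff v r]].
have bdS r : exists2 B, 0 <= B & forall v y, 0 < v -> v <= 2 * r -> P v y -> y <= B.
  have [B hB] := bd (2 * r); exists (Num.max 0 B); first by rewrite le_max lexx.
  move=> v y v0 vr Pvy; rewrite le_max (hB v y) ?orbT//; lra.
have leS r B : 0 <= B -> (forall v y, 0 < v -> v <= 2 * r -> P v y -> y <= B) ->
    forall z, S r z -> z <= B.
  move=> B0 hB z [-> //|[v [y [v0 y0 Pvy ->]]]].
  have [vr|rv] := leP v (2 * r); last by rewrite cutoff_eq0 ?mulr0// ltW.
  by apply: le_trans (hB _ _ v0 vr Pvy); rewrite ler_piMr.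
have S0 r : S r !=set0 by exists 0; left.
have supS r : has_sup (S r).
  by split=> //; have [B B0 hB] := bdS r; exists B => z; exact: leS.
pose h r := sup (S r).
have h_ge r z : S r z -> z <= h r by move=> Sz; exact: ub_le_sup (supS r).2 _ Sz.
have h_le r B : (forall z, S r z -> z <= B) -> h r <= B.
  by move=> hB; apply: ge_sup.
have h_ge0 r : 0 <= h r by apply: h_ge; left.
have h_homo r s : r <= s -> h r <= h s.
  move=> rs; apply: h_le => z [->//|[v [y [v0 y0 Pvy ->]]]].
  apply: (@le_trans _ _ (y * cutoff v s)); first by rewrite ler_wpM2l// cutoff_homo.
  by apply: h_ge; right; exists v, y.
have h_small e : 0 < e -> exists2 d, 0 < d & forall r, r <= d -> h r <= e.
  move=> e0; have [d d0 hd] := lim0 _ e0; exists (d / 2); first lra.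
  move=> r rd; apply: h_le; apply: leS; first exact: ltW.
  by move=> v y v0 vr; apply: hd; lra.
have hN r : r <= 0 -> h r = 0.
  move=> r0; apply/le_anti; rewrite h_ge0 andbT.
  by apply: h_le => z [->//|[v [y [v0 y0 Pvy ->]]]]; rewrite cutoff_eq0 ?mulr0//; lra.
have ch : continuous h.
  move=> r0; have [r00|r00] := leP r0 0.
    rewrite /continuous_at (hN _ r00); apply/cvgrPdist_le => e e0.
    have [d d0 hd] := h_small e e0.
    near=> r; rewrite sub0r normrN ger0_norm// hd//.
    suff : `|r0 - r| < d by rewrite ltr_norml; lra.
    by near: r; have /cvgrPdist_lt := @cvg_id _ (nbhs r0); apply.
  have [B B0 hB] := bdS (2 * r0).
  have lip r s : (r = r0 \/ s = r0) -> `|r - r0| < r0 / 2 -> `|s - r0| < r0 / 2 ->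
      h r <= h s + B * (4 / r0) * `|r - s|.
    move=> rs hr hs.
    have C0 : 0 <= B * (4 / r0) * `|r - s|.
      by rewrite mulr_ge0// mulr_ge0// divr_ge0// ltW.
    apply: h_le => z [->|[v [y [v0 y0 Pvy ->]]]]; first by rewrite addr_ge0.
    move: hr hs; rewrite !ltr_norml => hr hs.
    have [vr|rv] := leP v (2 * (2 * r0)); last first.
      by rewrite cutoff_eq0 ?mulr0 ?addr_ge0//; lra.
    have yB := hB _ _ v0 vr Pvy.
    have hk : cutoff v r <= cutoff v s + 4 / r0 * `|r - s|.
      case: rs hr hs => -> hr hs.
        have := @cutoff_lip v s r0 v0 r00; rewrite (distrC r0) ltr_norml.
        by move=> /(_ hs); rewrite ler_norml; lra.
      have := @cutoff_lip v r r0 v0 r00; rewrite ltr_norml.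
      by move=> /(_ hr); rewrite ler_norml; lra.
    apply: (@le_trans _ _ (y * (cutoff v s + 4 / r0 * `|r - s|))).
      by rewrite ler_wpM2l.
    rewrite mulrDr lerD//; first by apply: h_ge; right; exists v, y.
    rewrite mulrA ler_wpM2r// ler_wpM2r// divr_ge0//; lra.
  apply/cvgrPdist_le => e e0.
  have C0 : 0 < B * (4 / r0) + 1.
    by rewrite ltr_wpDl// mulr_ge0// divr_ge0//; lra.
  near=> r.
  have hr : `|r - r0| < r0 / 2.
    rewrite distrC; near: r.
    by have /cvgrPdist_lt := @cvg_id _ (nbhs r0); apply; lra.
  have h0 : `|r0 - r0| < r0 / 2 by rewrite subrr normr0; lra.
  have hr2 : `|r - r0| < e / (B * (4 / r0) + 1).
    rewrite distrC; near: r.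
    by have /cvgrPdist_lt := @cvg_id _ (nbhs r0); apply; rewrite divr_gt0.
  have : B * (4 / r0) * `|r - r0| <= e.
    move: hr2; rewrite ltr_pdivlMr// => /ltW; apply: le_trans.
    by rewrite mulrC ler_wpM2l// lerDl.
  have := lip r r0 (or_intror erefl) hr h0.
  have := lip r0 r (or_introl erefl) h0 hr.
  by rewrite (distrC r0 r) ler_norml; lra.
have gP r : 0 <= r -> r <= r + h r by rewrite lerDl.
exists (fun r => r + h r); split=> //.
- split; first apply: class_K_of_continuous.
  + by move=> r; apply: cvgD; [exact: cvg_id|exact: ch].
  + by move=> r s r0 rs; rewrite ltr_leD// h_homo// ltW.
  + by rewrite hN// addr0.
  + move=> A; exists (Num.max 0 A + 1); first by rewrite addr_ge0// le_max lexx.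
    apply: (@lt_le_trans _ _ (Num.max 0 A + 1)); last by rewrite lerDl.
    by rewrite ltr_pwDr// le_max lexx orbT.
- move=> v y v0 Pvy; have [y0|y0] := leP y 0.
    by apply: (le_trans y0); rewrite addr_ge0.
  move: v0; rewrite le_eqVlt => /orP[/eqP v0|v0]; last first.
    apply: (@le_trans _ _ (h v)); last by rewrite lerDr ltW.
    by apply: h_ge; right; exists v, y; split=> //; [exact: ltW|rewrite cutoff_eq1// mulr1].
  have y20 : 0 < y / 2 by lra.
  have [d d0 hd] := lim0 (y / 2) y20.
  suff : y <= y / 2 by lra.
  by apply: (hd v) => //; rewrite -v0 lexx ltW.
Unshelve. all: by end_near. Qed.

End ComparisonLemmas.

(** * Exponential form of KL bounds *)

Section Sontag.
Variable R : realType.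
Implicit Types (a g : R -> R) (b : R -> R -> R).

Lemma class_K_small a e : class_K a -> 0 < e ->
  exists2 d, 0 < d & forall r, 0 <= r <= d -> a r <= e.
Proof.
move=> Ka e0; have := class_K_ext_continuous Ka (x := 0).
move=> /cvgrPdist_le /(_ e e0) [d /= d0 hd]; exists (d / 2); first lra.
move=> r /andP[r0 rd]; have := hd r.
rewrite /ball_/= sub0r normrN ger0_norm// !max_r//.
have [_ _ ->] := Ka; rewrite sub0r normrN ger0_norm ?(class_K_ge0 Ka)//.
by apply; lra.
Qed.

(** Conjugating by [r |-> 1 / r] exchanges the behaviour of a comparison
    function at 0 with its behaviour at infinity, so that a majorant of large
    values becomes a minorant of small ones. *)
Lemma Kinfty_conj_inv g : class_Kinfty g -> (forall r, 0 <= r -> r <= g r) ->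
  exists a, [/\ class_Kinfty a & forall s, 0 < s -> a s = (g s^-1)^-1].
Proof.
move=> [Kg _] gid; exists (fun s => if s <= 0 then 0 else (g s^-1)^-1).
have gt0 s : 0 < s -> 0 < g s^-1 by move=> s0; rewrite class_K_gt0 ?invr_gt0.
split; last by move=> s s0; rewrite leNgt s0.
split; first apply: class_K_of_continuous.
- move=> s; have [s0|s0|->] := ltgtP s 0.
  + rewrite /continuous_at (ltW s0).
    apply: cvg_near_cst; near=> x; rewrite ifT// ltW//.
    by near: x; exact: lt_nbhsl.
  + rewrite /continuous_at (leNgt s) s0/=.
    have L : (fun x : R => (g (Num.max 0 x^-1))^-1) @ s --> (g s^-1)^-1.
      rewrite -[X in (g X)^-1](@max_r _ _ 0) ?invr_ge0 ?(ltW s0)//.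
      apply: cvgV; first by rewrite max_r ?invr_ge0 ?(ltW s0)// gt_eqF// gt0.
      apply: (@cvg_comp _ _ _ (fun x : R => x^-1) (fun x : R => g (Num.max 0 x))).
        by apply: cvgV; [rewrite gt_eqF|exact: cvg_id].
      exact: class_K_ext_continuous.
    apply: cvg_trans L; apply: near_eq_cvg; near=> x.
    have x0 : 0 < x by near: x; exact: lt_nbhsr.
    by rewrite leNgt x0/= max_r// invr_ge0 ltW.
  + rewrite /continuous_at lexx; apply/cvgrPdist_le => e e0.
    near=> x; rewrite sub0r normrN.
    have [x0|x0] := leP x 0; first by rewrite normr0 ltW.
    rewrite gtr0_norm ?invr_gt0 ?gt0//.
    rewrite invf_ple ?posrE ?gt0//; apply: (@le_trans _ _ x^-1); last first.
      by rewrite gid// invr_ge0 ltW.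
    rewrite lef_pV2 ?posrE//; apply: (le_trans (ler_norm _)).
    suff : `|0 - x| < e by rewrite sub0r normrN => /ltW.
    by near: x; have /cvgrPdist_lt := @cvg_id _ (nbhs (0 : R)); apply.
- move=> r s r0 rs; have s0 : 0 < s by exact: le_lt_trans rs.
  rewrite (leNgt s) s0/=; have [r0'|r0'] := leP r 0; first by rewrite invr_gt0 gt0.
  rewrite ltf_pV2 ?posrE ?gt0//; have [_ inc _] := Kg.
  by rewrite inc ?invr_ge0 ?(ltW s0)// ltf_pV2 ?posrE.
- by rewrite lexx.
- move=> A; have A1 : 0 < `|A| + 1 by rewrite ltr_wpDl.
  have [|d d0 hd] := class_K_small Kg (e := (`|A| + 1)^-1); first by rewrite invr_gt0.
  exists d^-1; first by rewrite invr_ge0 ltW.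
  rewrite leNgt invr_gt0 d0/= invrK.
  apply: (@lt_le_trans _ _ (`|A| + 1)); first by rewrite ltr_pwDr// ler_norm.
  rewrite -[leLHS]invrK lef_pV2 ?posrE ?invr_gt0 ?(class_K_gt0 Kg)//.
  by rewrite hd// lexx ltW.
Unshelve. all: by end_near. Qed.

Lemma class_KL_eventually b r e : class_KL b -> 0 <= r -> 0 < e ->
  exists2 T, 0 <= T & forall t, T <= t -> b r t <= e.
Proof.
move=> [_ b0 _ _ bl] r0 e0; have /cvgrPdist_le /(_ e e0) := bl r r0.
move=> [T [_ hT]]; exists (Num.max 0 (T + 1)); first by rewrite le_max lexx.
move=> t; rewrite ge_max => /andP[t0 Tt].
have := hT t; rewrite sub0r normrN ger0_norm ?b0//; apply.
by rewrite (lt_le_trans _ Tt)// ltrDl.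
Qed.

(** This is Sontag's lemma on KL functions. A gauge [a] that is flat enough at 0
    makes [a (b r t)] decay like [e ^ (- 4 t)], but with a constant that need not
    vanish with [r]; half of that rate is then traded for a factor vanishing
    with [r]. *)
Lemma class_KL_exponential b : class_KL b -> exists a a2,
  [/\ class_Kinfty a, class_Kinfty a2 & forall r t, 0 <= r -> 0 <= t ->
      expR (2 * t) * a (b r t) <= a2 r].
Proof.
move=> KLb; have [_ b0 bK bdecr _] := KLb.
have bhomo r s t : 0 <= r -> r <= s -> 0 <= t -> b r t <= b s t.
  by move=> r0 rs t0; exact: class_K_homo (bK t t0) r0 rs.
(* With [v = 1 / b r t], the pairs of [P] express that [a (b r t)] should be at
   most [e ^ (- 4 t)] whenever [b r t <= 1 / r], where [a s = 1 / g (1 / s)]. For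
   [v <= V] only times with [b V t >= 1 / V] occur, and these are bounded. *)
pose P v y := exists r t, [/\ 0 <= r, 0 <= t, r <= v, v^-1 <= b r t &
  0 < v /\ y = expR (4 * t)].
have [r|e e0|g [Kg gid gP]] := @Kinfty_majorant R P.
- have [r0|r0] := leP r 0.
    by exists 0 => v y /andP[_ vr] [? [? [_ _ _ _ [v0 _]]]]; lra.
  have [|T T0 hT] := class_KL_eventually (r := r) (e := (2 * r)^-1) KLb (ltW r0).
    by rewrite invr_gt0; lra.
  exists (expR (4 * T)) => v y /andP[_ vr] [s [t [s0 t0 sv vb [v0 ->]]]].
  rewrite ler_expR ler_pM2l// leNgt; apply/negP => /ltW Tt.
  have h1 := bhomo s r t s0 (le_trans sv vr) t0.
  have h2 := hT t Tt.
  have : r^-1 <= (2 * r)^-1.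
    rewrite (le_trans _ h2)// (le_trans _ h1)// (le_trans _ vb)//.
    by rewrite lef_pV2 ?posrE.
  rewrite lef_pV2 ?posrE//; lra.
- have m0 : 0 <= b 1 0 by rewrite b0.
  exists (Num.min 1 (b 1 0 + 1)^-1); first by rewrite lt_min ltr01 invr_gt0; lra.
  move=> v y /andP[_]; rewrite le_min => /andP[v1 vb] [s [t [s0 t0 sv vbs [v0 _]]]].
  have h1 := bhomo s 1 t s0 (le_trans sv v1) t0.
  have h2 := bdecr 1 0 t ler01 (lexx _) t0.
  suff : b 1 0 + 1 <= v^-1 by lra.
  by rewrite -[leLHS]invrK lef_pV2 ?posrE ?invr_gt0//; lra.
have [a [Ka aE]] := Kinfty_conj_inv Kg gid.
have aP r t : 0 < r -> 0 <= t -> b r t <= r^-1 -> expR (4 * t) * a (b r t) <= 1.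
  move=> r0 t0 br; have := b0 r t (ltW r0) t0.
  rewrite le_eqVlt => /orP[/eqP <-|brt]; first by case: (Ka) => -[_ _ ->]; rewrite mulr0.
  rewrite aE// ler_pdivrMr ?(class_K_gt0 Kg.1) ?invr_gt0// mul1r.
  apply: gP; first by rewrite invr_ge0 ltW.
  exists r, t; split; rewrite ?(ltW r0)//.
  - by rewrite -[leLHS]invrK lef_pV2 ?posrE ?invr_gt0.
  - by rewrite invrK.
  - by rewrite invr_gt0.
have abd r0 : 0 < r0 -> exists2 C, 0 <= C & forall r t, 0 <= r <= r0 -> 0 <= t ->
    expR (4 * t) * a (b r t) <= C.
  move=> r00; have [|T T0 hT] := class_KL_eventually (r := r0) (e := r0^-1) KLb (ltW r00).
    by rewrite invr_gt0.
  have a00 : 0 <= a (b r0 0) by rewrite (class_K_ge0 Ka.1)// b0// ltW.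
  exists (1 + expR (4 * T) * a (b r0 0)).
    by rewrite addr_ge0// mulr_ge0// expR_ge0.
  move=> r t /andP[] + rr0 t0; rewrite le_eqVlt => /orP[/eqP <-|rp].
    have [_ _ ->] := bK t t0; have [[_ _ ->] _] := Ka.
    by rewrite mulr0 addr_ge0// mulr_ge0// expR_ge0.
  have [Tt|tT] := leP T t.
    apply: (@le_trans _ _ 1); last by rewrite lerDl mulr_ge0// expR_ge0.
    apply: aP => //; apply: (le_trans (bhomo r r0 t (ltW rp) rr0 t0)).
    by apply: (le_trans (hT t Tt)); rewrite lef_pV2 ?posrE.
  apply: (@le_trans _ _ (expR (4 * T) * a (b r0 0))); last by rewrite lerDr.
  apply: ler_pM; rewrite ?expR_ge0 ?(class_K_ge0 Ka.1) ?b0 ?(ltW rp)//.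
    by rewrite ler_expR ler_pM2l// ltW.
  apply: (class_K_homo Ka.1); first by rewrite b0// ltW.
  by rewrite (le_trans (bhomo r r0 t (ltW rp) rr0 t0))// bdecr// ltW.
pose Q r y := exists2 t, 0 <= t & 0 <= r /\ y = expR (2 * t) * a (b r t).
have ab0 r t : 0 <= r -> 0 <= t -> 0 <= a (b r t).
  by move=> *; rewrite (class_K_ge0 Ka.1)// b0.
have e4 (t : R) : expR (4 * t) = expR (2 * t) * expR (2 * t).
  by rewrite -expRD; congr expR; lra.
have [r|e e0|a2 [Ka2 _ a2P]] := @Kinfty_majorant R Q.
- have r1 : 0 < Num.max 1 r by rewrite lt_max ltr01.
  have [C C0 hC] := abd _ r1; exists C => v y /andP[v0 vr] [t t0 [_ ->]].
  apply: le_trans (hC v t _ t0); last by rewrite v0 le_max vr orbT.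
  by rewrite ler_wpM2r ?ab0// ler_expR; lra.
(* The square of [e ^ (2 t) a (b r t)] is at most [C * a (b r 0)]. *)
- have [C C0 hC] := abd 1 ltr01.
  have [|d d0 hd] := class_K_small (e := e ^+ 2 / (C + 1)) (class_K_comp Ka.1 (bK 0 (lexx _))).
    by rewrite divr_gt0 ?exprn_gt0//; lra.
  exists (Num.min 1 d); first by rewrite lt_min ltr01.
  move=> r y /andP[r0]; rewrite le_min => /andP[r1 rd] [t t0 [_ ->]].
  have y0 : 0 <= expR (2 * t) * a (b r t) by rewrite mulr_ge0 ?expR_ge0 ?ab0.
  rewrite -(ler_pXn2r (n := 2))// ?nnegrE ?(ltW e0)//.
  rewrite expr2 mulrACA -e4 mulrA.
  have h1 : expR (4 * t) * a (b r t) <= C by apply: hC => //; rewrite r0.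
  have h2 : a (b r t) <= e ^+ 2 / (C + 1).
    apply: le_trans (hd r _); last by rewrite r0.
    by apply: (class_K_homo Ka.1); rewrite ?b0// bdecr.
  apply: (@le_trans _ _ (C * (e ^+ 2 / (C + 1)))).
    by apply: ler_pM; rewrite ?mulr_ge0 ?expR_ge0 ?ab0.
  by rewrite mulrCA ler_piMr ?exprn_ge0 ?(ltW e0)// ler_pdivrMr; lra.
exists a, a2; split=> // r t r0 t0; apply: a2P => //.
by exists t.
Qed.

End Sontag.

(** * Squared Euclidean norm and Gronwall's inequality *)

Section SquaredNorm.
Variables (R : realType) (n : nat).
Implicit Types (x y z : 'rV[R]_n) (f : 'rV[R]_n -> 'rV[R]_n).

Definition nsq x : R := \sum_(i < n) x ord0 i ^+ 2.

Lemma nsq_ge0 x : 0 <= nsq x.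
Proof. by apply: sumr_ge0 => i _; rewrite sqr_ge0. Qed.

Lemma nsq0 : nsq 0 = 0.
Proof. by apply: big1 => i _; rewrite mxE expr0n. Qed.

Lemma nsqN x : nsq (- x) = nsq x.
Proof. by apply: eq_bigr => i _; rewrite mxE sqrrN. Qed.

Lemma nsq_sub x y : nsq (x - y) = nsq (y - x).
Proof. by rewrite -nsqN opprB. Qed.

(** A substitute for the triangle inequality that avoids square roots. *)
Lemma nsq_split x y : nsq y <= 2 * nsq (y - x) + 2 * nsq x.
Proof.
rewrite /nsq !mulr_sumr -big_split/=; apply: ler_sum => i _.
rewrite !mxE; set p := x _ _; set q := y _ _.
by have := sqr_ge0 (q - 2 * p); nra.
Qed.

Lemma enorm_ge0 x : 0 <= enorm x.
Proof. exact: sqrtr_ge0. Qed.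

Lemma sqr_enorm x : enorm x ^+ 2 = nsq x.
Proof. by rewrite sqr_sqrtr// nsq_ge0. Qed.

Lemma enorm_le_sqr x r : 0 <= r -> (enorm x <= r) = (nsq x <= r ^+ 2).
Proof. by move=> r0; rewrite -sqr_enorm ler_pXn2r// nnegrE enorm_ge0. Qed.

Lemma sqr_norm_le_nsq x : `|x| ^+ 2 <= nsq x.
Proof.
have [->|x0] := eqVneq `|x| 0; first by rewrite expr0n/= nsq_ge0.
have [[i j] /= xi] := mx_norm_neq0 x0.
have -> : `|x| = `|x i j| by [].
rewrite real_normK ?num_real// ord1 /nsq (bigD1 j)//= lerDl.
by apply: sumr_ge0 => k _; rewrite sqr_ge0.
Qed.

Lemma norm_le_enorm x : `|x| <= enorm x.
Proof.
by rewrite -(ler_pXn2r (n := 2))// ?nnegrE ?enorm_ge0// sqr_enorm sqr_norm_le_nsq.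
Qed.

Lemma nsq_eq0 x : nsq x <= 0 -> x = 0.
Proof.
move=> x0; apply/eqP; rewrite -normr_le0 (le_trans (norm_le_enorm x))//.
by rewrite enorm_le_sqr// expr0n.
Qed.

Lemma coord_le_norm x i : `|x ord0 i| <= `|x|.
Proof.
rewrite [leRHS]/Num.Def.normr/= mx_normrE.
exact: (le_bigmax _ (fun ij : 'I_1 * 'I_n => `|x ij.1 ij.2|) (ord0, i)).
Qed.

Lemma nsq_le_sqr_norm x : nsq x <= n%:R * `|x| ^+ 2.
Proof.
rewrite /nsq; apply: (@le_trans _ _ (\sum_(i < n) `|x| ^+ 2)).
  apply: ler_sum => i _; rewrite -[leLHS]real_normK ?num_real//.
  by rewrite ler_pXn2r ?nnegrE// coord_le_norm.
by rewrite sumr_const card_ord mulr_natl.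
Qed.

Lemma nsq_continuous : continuous nsq.
Proof.
have : continuous (fun x : 'rV[R]_n => \sum_(i < n) x ord0 i ^+ 2).
  apply: continuous_big => [|i _ x]; first exact: add_continuous.
  apply: (@continuous_comp _ _ _ (fun y : 'rV[R]_n => y ord0 i) (fun r => r ^+ 2)).
    exact: coord_continuous.
  exact: exprn_continuous.
by [].
Qed.

Lemma nsq_sub_cvg0 x : (fun y => nsq (y - x)) @ x --> (0 : R).
Proof.
rewrite -nsq0 -(subrr x).
apply: (@cvg_comp _ _ _ (fun y : 'rV[R]_n => y - x) nsq).
  by apply: (@cvgB _ _ _ (nbhs x) _ id (cst x)); [exact: cvg_id | exact: cvg_cst].
exact: nsq_continuous.
Qed.

Lemma enorm_continuous : continuous (@enorm R n).
Proof.
move=> x; apply: (@continuous_comp _ _ _ nsq Num.sqrt).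
  exact: nsq_continuous.
exact: sqrt_continuous.
Qed.

Lemma compact_nsq_ball r : compact [set x : 'rV[R]_n | nsq x <= r].
Proof.
apply: bounded_closed_compact.
  exists (Num.sqrt r); split; first exact: num_real.
  move=> M rM x /= xr; apply: le_trans (ltW rM).
  by rewrite (le_trans (norm_le_enorm x))// ler_wsqrtr.
apply: (preimage_closed _ (@closed_le _ r)) => x _.
exact: nsq_continuous.
Qed.

Lemma locally_lipschitz_continuous f : locally_lipschitz f -> continuous f.
Proof.
move=> fl x; have [U Ux [L [_ hL]]] := fl x.
have {}hL := hL (Num.max 0 L + 1) _.
set M := _ + 1 in hL; have M0 : 0 < M by rewrite ltr_wpDl// le_max lexx.
have {}hL y : U y -> `|f x - f y| <= M * `|x - y|.
  move=> Uy; apply: (hL _ (x, y)); last by split=> //; exact: nbhs_singleton.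
  by rewrite /M ltr_pwDr// le_max lexx orbT.
apply/(@cvgrPdist_le _ _ _ (nbhs x)) => e e0; near=> y.
have Uy : U y by near: y.
apply: (le_trans (hL _ Uy)); rewrite mulrC -ler_pdivlMr// ltW//.
near: y; have /cvgrPdist_lt := @cvg_id _ (nbhs x); apply.
by rewrite divr_gt0.
Unshelve. all: by end_near. Qed.

(** The Lipschitz estimate is a local property of the pairs [(y, z)]: near the
    diagonal it is the hypothesis, and away from it the denominator
    [nsq (y - z)] is bounded below. Compactness of the set of pairs makes the
    constant uniform. *)
Lemma locally_lipschitz_ball f r : locally_lipschitz f ->
  exists2 C, 0 <= C & forall y z, nsq y <= r -> nsq z <= r ->
    nsq (f y - f z) <= C * nsq (y - z).
Proof.
move=> fl; have cf := locally_lipschitz_continuous fl.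
have cK := compact_setX (@compact_nsq_ball r) (@compact_nsq_ball r).
pose P (C : R) (p : 'rV[R]_n * 'rV[R]_n) :=
  nsq (f p.1 - f p.2) <= C * nsq (p.1 - p.2).
have cover (p : 'rV[R]_n * 'rV[R]_n) : \forall p' \near p & C \near +oo, P C p'.
  have [pE|pN] := eqVneq p.1 p.2.
    have [U Ux [L [_ hL]]] := fl p.1.
    have {}hL := hL (Num.max 0 L + 1) _.
    set M := _ + 1 in hL; have M0 : 0 < M by rewrite ltr_wpDl// le_max lexx.
    exists ((U `*` U), [set C | n%:R * M ^+ 2 <= C]).
      split=> /=; last by apply: nbhs_pinfty_ge; exact: num_real.
      exists (U, U); last exact: subset_refl.
      by split; [exact: Ux | rewrite /= -pE; exact: Ux].
    move=> [[y z] C] [[/= Uy Uz] hC]; rewrite /P/=.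
    apply: (le_trans (nsq_le_sqr_norm _)).
    apply: (@le_trans _ _ (n%:R * M ^+ 2 * `|y - z| ^+ 2)).
      rewrite -mulrA ler_wpM2l// -exprMn ler_pXn2r ?nnegrE ?mulr_ge0 ?(ltW M0)//.
      apply: (hL _ (y, z)) => //.
      by rewrite /M ltr_pwDr// le_max lexx orbT.
    apply: ler_pM; [by rewrite mulr_ge0// sqr_ge0|by rewrite sqr_ge0|exact: hC|].
    exact: sqr_norm_le_nsq.
  have d0 : 0 < nsq (p.1 - p.2).
    rewrite lt_neqAle nsq_ge0 andbT eq_sym; apply: contra pN => /eqP h.
    by rewrite -subr_eq0; apply/eqP/nsq_eq0; rewrite h.
  pose g1 (q : 'rV[R]_n * 'rV[R]_n) := nsq (q.1 - q.2).
  pose g2 (q : 'rV[R]_n * 'rV[R]_n) := nsq (f q.1 - f q.2).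
  have cg1 : {for p, continuous g1}.
    apply: (@continuous_comp _ _ _ (fun q : 'rV[R]_n * 'rV[R]_n => q.1 - q.2) nsq).
      by apply: cvgB; [exact: cvg_fst | exact: cvg_snd].
    exact: nsq_continuous.
  have cg2 : {for p, continuous g2}.
    apply: (@continuous_comp _ _ _ (fun q : 'rV[R]_n * 'rV[R]_n => f q.1 - f q.2) nsq).
      apply: cvgB.
        by apply: (@continuous_comp _ _ _ fst f); [exact: cvg_fst | exact: cf].
      by apply: (@continuous_comp _ _ _ snd f); [exact: cvg_snd | exact: cf].
    exact: nsq_continuous.
  exists ([set q | g1 p / 2 < g1 q /\ g2 q < g2 p + 1],
          [set C | (g2 p + 1) / (g1 p / 2) <= C]).
    split=> /=; last by apply: nbhs_pinfty_ge; exact: num_real.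
    apply: filterI.
      by apply: (cvgr_gt _ cg1); rewrite /g1; lra.
    by apply: (cvgr_lt _ cg2); lra.
  move=> [q C] [[/= h1 h2] hC]; rewrite /P.
  have g10 : 0 < g1 p / 2 by rewrite divr_gt0.
  apply: (le_trans (ltW h2)).
  apply: (@le_trans _ _ ((g2 p + 1) / (g1 p / 2) * g1 q)).
    rewrite mulrAC ler_pdivlMr// ler_wpM2l ?(ltW h1)// addr_ge0//.
    exact: nsq_ge0.
  by rewrite -/(g1 q) ler_wpM2r//; exact: nsq_ge0.
have /compact_near_coveringP/(_ _ +oo P) := cK.
move=> /(_ _ (fun p _ => cover p)) h.
have [C [C0 hC]] : exists C : R, 0 <= C /\
    [set x | nsq x <= r] `*` [set x | nsq x <= r] `<=` P C.
  apply: (@filter_ex _ (pinfty_nbhs R)).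
  apply: filterI; [apply: nbhs_pinfty_ge; exact: num_real | exact: h].
by exists C => // y z yr zr; exact: (hC (y, z)).
Qed.

Lemma is_derive_coord (u : R -> 'rV[R]_n) (t : R) (du : 'rV[R]_n) i :
  is_derive t 1 u du -> is_derive t 1 (fun s => u s ord0 i) (du ord0 i).
Proof.
move=> [dut <-]; split; first by have /derivable_mxP := dut; apply.
by rewrite derive_mx// mxE.
Qed.

Lemma is_derive_nsq (u : R -> 'rV[R]_n) (t : R) (du : 'rV[R]_n) : is_derive t 1 u du ->
  is_derive t 1 (nsq \o u) (\sum_(i < n) 2 * u t ord0 i * du ord0 i).
Proof.
move=> hu.
have -> : nsq \o u = \sum_(i < n) (fun s => u s ord0 i ^+ 2).
  by apply/funext => s; rewrite fct_sumE.
have hi i : is_derive t 1 (fun s => u s ord0 i ^+ 2)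
    (2 * u t ord0 i * du ord0 i).
  have hi := is_derive_coord i hu.
  have -> : (fun s => u s ord0 i ^+ 2) = (fun s : R => u s ord0 i : R) ^+ 2.
    by apply/funext => s; rewrite exprfctE.
  by apply: is_derive_eq; rewrite expr1.
exact: is_derive_sum.
Qed.

(** Squared norms avoid the Cauchy-Schwarz inequality: the derivative of
    [nsq (u - v)] is estimated coordinatewise by [2 d e <= d ^ 2 + e ^ 2], where
    [d] is a coordinate of [u - v] and [e] one of its derivative; this is the
    origin of the constant [1 + C]. *)
Lemma gronwall_nsq f (u v : R -> 'rV[R]_n) (a b C : R) :
  {within `[a, b], continuous u} -> {within `[a, b], continuous v} ->
  (forall t, a < t < b -> is_derive t 1 u (f (u t))) ->
  (forall t, a < t < b -> is_derive t 1 v (f (v t))) ->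
  (forall t, a < t < b -> nsq (f (u t) - f (v t)) <= C * nsq (u t - v t)) ->
  forall t, a <= t <= b ->
    nsq (u t - v t) <= expR ((1 + C) * (t - a)) * nsq (u a - v a).
Proof.
move=> cu cv du dv lip t /andP[at_ tb].
have amgm (p q : R) : 2 * p * q <= p ^+ 2 + q ^+ 2.
  by have := sqr_ge0 (p - q); nra.
pose w s := expR (- (1 + C) * (s - a)) * nsq (u s - v s).
have dw s : a < s < b -> exists2 d, is_derive s 1 w d & d <= 0.
  move=> asb; have hu := du s asb; have hv := dv s asb.
  have hd := is_derive_nsq (is_deriveB hu hv).
  have he : is_derive s 1 (fun s => expR (- (1 + C) * (s - a)))
      (- (1 + C) * expR (- (1 + C) * (s - a))).
    apply: is_derive_eq; rewrite /GRing.scale/=; ring.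
  have := is_deriveM he hd.
  set d := (X in is_derive _ _ _ X); exists d => //.
  have -> : d = expR (- (1 + C) * (s - a)) *
      (\sum_(i < n) 2 * (u s - v s) ord0 i * (f (u s) - f (v s)) ord0 i -
       (1 + C) * nsq (u s - v s)).
    by rewrite /d /GRing.scale/=; ring.
  rewrite pmulr_rle0 ?expR_gt0//.
  have : \sum_(i < n) 2 * (u s - v s) ord0 i * (f (u s) - f (v s)) ord0 i <=
      nsq (u s - v s) + nsq (f (u s) - f (v s)).
    rewrite /nsq -big_split/=; apply: ler_sum => i _.
    exact: amgm.
  have := lip s asb.
  lra.
have wd r : r \in `]a, b[%R -> derivable w r 1.
  by move=> /[!in_itv]/= /dw[d [+ _] _].
have wd0 r : r \in `]a, b[%R -> derive1 w r <= 0.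
  by move=> /[!in_itv]/= /dw[d [_ +] d0]; rewrite derive1E => ->.
have cw : {within `[a, b], continuous w}.
  have cn : {within `[a, b], continuous (nsq \o (u - v))}.
    apply: within_continuous_comp; first by move=> z _; exact: nsq_continuous.
    move: cu cv => /subspace_continuousP cu /subspace_continuousP cv.
    by apply/subspace_continuousP => s sab; apply: cvgB; [exact: cu|exact: cv].
  have ce : {within `[a, b], continuous (fun s => expR (- (1 + C) * (s - a)))}.
    apply: continuous_subspaceT => s.
    apply: (@continuous_comp _ _ _ (fun s : R => - (1 + C) * (s - a)) expR).
      apply: cvgM; first exact: cvg_cst.
      by apply: cvgB; [exact: cvg_id|exact: cvg_cst].
    exact: continuous_expR.
  move: ce cn => /subspace_continuousP ce /subspace_continuousP cn.
  by apply/subspace_continuousP => s sab; apply: cvgM; [exact: ce|exact: cn].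
have hw : w t <= w a.
  apply: (ler0_derive1_le_cc wd wd0 cw); last exact: at_.
    by rewrite in_itv/= at_ tb.
  by rewrite in_itv/= lexx (le_trans at_).
move: hw; rewrite /w subrr mulr0 expR0 mul1r => hw.
apply: le_trans (ler_wpM2l (expR_ge0 ((1 + C) * (t - a))) hw).
by rewrite mulrA -expRD mulNr subrr expR0 mul1r.
Qed.

End SquaredNorm.

(** * Flows of locally Lipschitz fields *)

Lemma is_derive1_shift (R : realType) (V : normedModType R) (u : R -> V)
    (c t : R) (du : V) :
  is_derive (t + c) 1 u du -> is_derive t 1 (fun s => u (s + c)) du.
Proof.
have E : (fun h : R => h^-1 *: ((u \o shift (t + c)) (h *: 1) - u (t + c))) =
  (fun h : R => h^-1 *: (((fun s => u (s + c)) \o shift t) (h *: 1) - u (t + c))).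
  by apply/funext => h /=; rewrite addrA.
move=> [d1 d2]; split; first by rewrite /derivable -E.
by rewrite -d2 /derive -E.
Qed.

Lemma is_derive1_continuous (R : realType) (V : normedModType R) (u : R -> V)
    (t : R) (du : V) : is_derive t 1 u du -> {for t, continuous u}.
Proof.
by move=> [d _]; apply/differentiable_continuous/derivable1_diffP.
Qed.

(** An a priori bound that improves itself strictly can never be violated: at
    the infimum of the times of violation it would have improved. *)
Lemma self_improving_bound (R : realType) (g : R -> R) (T : R) :
  continuous g ->
  (forall t, 0 <= t <= T -> (forall s, 0 <= s < t -> g s <= 1) -> g t < 1) ->
  forall t, 0 <= t <= T -> g t < 1.
Proof.
move=> cg hg t tT; rewrite ltNge; apply/negP => gt1.
pose A := [set s | 0 <= s <= T /\ 1 <= g s].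
have At : A t by [].
have infA : has_inf A by split; [exists t | exists 0 => s [/andP[]]].
set m := inf A.
have mT : 0 <= m <= T.
  have mt : m <= t by apply: (ge_inf infA.2).
  have m0 : 0 <= m by apply: lb_le_inf; [exists t | move=> s [/andP[]]].
  by rewrite m0/=; case/andP: tT => _; exact: le_trans.
have gm : g m < 1.
  apply: hg => // s /andP[s0 sm]; rewrite leNgt; apply/negP => /ltW gs.
  suff : m <= s by lra.
  by apply: (ge_inf infA.2); split=> //; rewrite s0/=; lra.
have [d /= d0 hd] : \forall s \near m, g s < 1 by exact: (cvgr_lt _ (cg m)).
have [a [aT ga] am] := inf_adherent d0 infA.
have ma : m <= a by apply: (ge_inf infA.2).
suff : g a < 1 by lra.
by apply: hd; rewrite /ball_/= ltr_norml; rewrite -/m in am; lra.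
Qed.

Section Flow.
Variables (R : realType) (n : nat) (f : 'rV[R]_n -> 'rV[R]_n).
Variable Phi : R -> 'rV[R]_n -> 'rV[R]_n.
Hypothesis f_lip : locally_lipschitz f.
Hypothesis f_flow : is_flow f Phi.
Implicit Types x y z : 'rV[R]_n.

Lemma flow0 x : Phi 0 x = x.
Proof. by have [[]] := f_flow x. Qed.

Lemma flow_derive x (t : R) : is_derive t 1 (Phi ^~ x) (f (Phi t x)).
Proof. by have [[_]] := f_flow x. Qed.

Lemma flow_continuous_time x : continuous (Phi ^~ x).
Proof. by move=> t; apply: is_derive1_continuous (flow_derive x t). Qed.

Lemma flow_add s t x : Phi (s + t) x = Phi s (Phi t x).
Proof.
have [_ /(_ (fun s => Phi (s + t) x))] := f_flow (Phi t x).
have sol : is_global_solution f (Phi t x) (fun s => Phi (s + t) x).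
  split; first by rewrite add0r.
  by move=> r; apply: (is_derive1_shift (flow_derive x _)).
by move=> /(_ sol) /(congr1 (fun u => u s)).
Qed.

Lemma flow_fixed0 t : f 0 = 0 -> Phi t 0 = 0.
Proof.
move=> f0; have [_ /(_ (cst 0))] := f_flow 0.
have sol : is_global_solution f 0 (cst 0).
  by split=> // s; rewrite f0; exact: is_derive_cst.
by move=> /(_ sol) /(congr1 (fun u => u t)) <-.
Qed.

Lemma nsq_bounded_within (u : R -> 'rV[R]_n) (a b : R) : a <= b ->
  {within `[a, b], continuous u} ->
  exists B, forall t, a <= t <= b -> nsq (u t) <= B.
Proof.
move=> ab cu; have cnu : {within `[a, b], continuous (@nsq R n \o u)}.
  by apply: within_continuous_comp => // z _; exact: nsq_continuous.
have [c cab hc] := EVT_max ab cnu; exists (nsq (u c)) => t tab.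
by apply: hc; rewrite in_itv.
Qed.

(** Uniqueness is assumed for solutions defined at all times; Gronwall's
    inequality localizes it to a segment, as the pieces of a switched solution
    require. *)
Lemma flow_unique_within (u : R -> 'rV[R]_n) (a b : R) :
  {within `[a, b], continuous u} ->
  (forall t, a < t < b -> is_derive t 1 u (f (u t))) ->
  forall t, a <= t <= b -> u t = Phi (t - a) (u a).
Proof.
move=> cu du t tab; have ab : a <= b by case/andP: tab; exact: le_trans.
pose v s := Phi (s - a) (u a).
have dv (s : R) : is_derive s 1 v (f (v s)).
  by apply: (is_derive1_shift (flow_derive (u a) _)).
have cv : {within `[a, b], continuous v}.
  apply: continuous_subspaceT => s; exact: is_derive1_continuous (dv s).
have [B hB] := nsq_bounded_within ab cu.
have [B' hB'] := nsq_bounded_within ab cv.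
have [C C0 hC] := locally_lipschitz_ball (Num.max B B') f_lip.
have := gronwall_nsq cu cv du (fun s _ => dv s) (C := C).
have lip s : a < s < b -> nsq (f (u s) - f (v s)) <= C * nsq (u s - v s).
  move=> /andP[/ltW as_ /ltW sb].
  by apply: hC; rewrite le_max ?hB ?hB' ?orbT// as_.
move=> /(_ lip t tab); rewrite /v subrr flow0 subrr nsq0 mulr0 => /nsq_eq0.
by move/eqP; rewrite subr_eq0 => /eqP.
Qed.

(** On a tube of radius 1 around the reference trajectory the field is
    Lipschitz, hence Gronwall's inequality applies as long as the other
    trajectory stays in the tube; started close enough, it never leaves. *)
Lemma flow_tube x T : 0 <= T -> exists K d, [/\ 0 < K, 0 < d &
  forall y t, nsq (y - x) < d -> 0 <= t <= T ->
    nsq (Phi t y - Phi t x) <= K * nsq (y - x)].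
Proof.
move=> T0; have cP z a b : {within `[a, b], continuous (Phi ^~ z)}.
  by apply: continuous_subspaceT => t; exact: flow_continuous_time.
have [B hB] := nsq_bounded_within T0 (cP x _ _).
have [C C0 hC] := locally_lipschitz_ball (2 + 2 * B) f_lip.
(* The radius [2 + 2 * B] comes from [nsq_split] in a tube of radius 1. *)
pose K := expR ((1 + C) * T); have K0 : 0 < K by exact: expR_gt0.
exists K, K^-1; split; rewrite ?invr_gt0// => y t yx tT.
pose g s := nsq (Phi s y - Phi s x).
have cg : continuous g.
  move=> s; apply: (@cvg_comp _ _ _ (fun s => Phi s y - Phi s x) (@nsq R n)).
    by apply: cvgB; exact: flow_continuous_time.
  exact: nsq_continuous.
have step s : 0 <= s <= T -> (forall r, 0 <= r < s -> g r <= 1) ->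
    g s <= K * nsq (y - x).
  move=> /andP[s0 sT] gr; have := gronwall_nsq (cP y 0 s) (cP x 0 s)
    (fun r _ => flow_derive y r) (fun r _ => flow_derive x r) (C := C).
  have lip r : 0 < r < s ->
      nsq (f (Phi r y) - f (Phi r x)) <= C * nsq (Phi r y - Phi r x).
    move=> /andP[/ltW r0 rs]; have gr1 : g r <= 1 by apply: gr; rewrite r0.
    have hx : nsq (Phi r x) <= B by apply: hB; rewrite r0/= (le_trans (ltW rs)).
    have hx0 := nsq_ge0 (Phi r x).
    apply: hC; last lra.
    by apply: (le_trans (nsq_split (Phi r x) _)); rewrite /g in gr1; lra.
  move=> /(_ lip s); rewrite s0 lexx => /(_ isT) h.
  apply: (le_trans h); rewrite !flow0 subr0.
  by rewrite ler_wpM2r ?nsq_ge0// ler_expR ler_wpM2l// addr_ge0.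
have g1 : forall s, 0 <= s <= T -> g s < 1.
  apply: (self_improving_bound cg) => s sT gs; apply: (le_lt_trans (step s sT gs)).
  by rewrite mulrC -ltr_pdivlMr// mul1r.
apply: step => // r /andP[r0 rt]; apply/ltW/g1.
by case/andP: tT => _ tT; rewrite r0/=; lra.
Qed.

(** Joint continuity in time and space: the tube estimate is uniform in time,
    which reduces the claim to continuity in time along the limit trajectory. *)
Lemma flow_cvg (I : Type) (F : set_system I) (S : I -> R) (Y : I -> 'rV[R]_n) s y :
  Filter F -> (forall i, 0 <= S i) -> S @ F --> s -> Y @ F --> y ->
  (fun i => Phi (S i) (Y i)) @ F --> Phi s y.
Proof.
move=> FF S0 Ss Yy.
have S1 : \forall i \near F, S i <= `|s| + 1.
  apply: (cvgr_le _ Ss); have := ler_norm s; lra.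
have [|K [d [K0 d0 hK]]] := @flow_tube y (`|s| + 1); first by rewrite addr_ge0.
have cn : (fun i => nsq (Y i - y)) @ F --> (0 : R).
  rewrite -(nsq0 R n) -(subrr y).
  apply: (@cvg_comp _ _ _ (fun i => Y i - y) (@nsq R n)); last exact: nsq_continuous.
  by apply: cvgB => //; exact: cvg_cst.
have c1 : (fun i => Phi (S i) (Y i) - Phi (S i) y) @ F --> (0 : 'rV[R]_n).
  apply/cvgrPdist_le => e e0; near=> i; rewrite sub0r normrN.
  have h1 : nsq (Y i - y) < d by near: i; exact: (cvgr_lt _ cn).
  have h2 : nsq (Y i - y) < e ^+ 2 / K.
    by near: i; apply: (cvgr_lt _ cn); rewrite divr_gt0// exprn_gt0.
  rewrite (le_trans (norm_le_enorm _))// enorm_le_sqr ?(ltW e0)//.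
  have h3 : S i <= `|s| + 1 by near: i.
  apply: (le_trans (hK (Y i) (S i) h1 _)); first by rewrite S0.
  by rewrite mulrC -ler_pdivlMr// ltW.
have c2 : (fun i => Phi (S i) y) @ F --> Phi s y.
  exact: (@cvg_comp _ _ _ S (Phi ^~ y) F _ _ Ss (@flow_continuous_time y s)).
rewrite -(add0r (Phi s y)).
have -> : (fun i => Phi (S i) (Y i)) =
    (fun i => (Phi (S i) (Y i) - Phi (S i) y) + Phi (S i) y).
  by apply/funext => i; rewrite subrK.
exact: cvgD.
Unshelve. all: by end_near. Qed.

Lemma flow_bounded T r : 0 <= T -> \forall B \near +oo,
  forall x t, nsq x <= r -> 0 <= t <= T -> nsq (Phi t x) <= B.
Proof.
move=> T0; have /compact_near_coveringP := @compact_nsq_ball R n r.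
pose P (B : R) x := forall t, 0 <= t <= T -> nsq (Phi t x) <= B.
have cover x : [set x | nsq x <= r] x -> \forall x' \near x & B \near +oo, P B x'.
  move=> _; have [K [d [K0 d0 hK]]] := flow_tube x T0.
  have cP : {within `[0, T], continuous (Phi ^~ x)}.
    by apply: continuous_subspaceT => t; exact: flow_continuous_time.
  have [B hB] := nsq_bounded_within T0 cP.
  exists ([set y | nsq (y - x) < d], [set B' | 2 * (K * d) + 2 * B <= B']).
    split=> /=; last by apply: nbhs_pinfty_ge; exact: num_real.
    by apply: (cvgr_lt _ (nsq_sub_cvg0 x)).
  move=> [y B'] [/= yd hB'] t tT; apply: le_trans hB'.
  apply: (le_trans (nsq_split (Phi t x) _)); apply: lerD; rewrite ler_pM2l//.
    by apply: (le_trans (hK y t yd tT)); rewrite ler_pM2l// ltW.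
  exact: hB.
move=> /(_ _ (pinfty_nbhs R) P _ cover); apply: filterS => B hB x t xr.
exact: (hB x xr).
Qed.

Lemma flow_small T e : f 0 = 0 -> 0 <= T -> 0 < e -> \forall d \near 0^'+,
  forall x t, enorm x <= d -> 0 <= t <= T -> enorm (Phi t x) <= e.
Proof.
move=> f0 T0 e0; have [K [d [K0 d0 hK]]] := flow_tube 0 T0.
near=> c => x t xc tT.
have c0 : 0 < c by near: c; exact: nbhs_right_gt.
have c1 : c <= 1 by near: c; apply: nbhs_right_le; lra.
have cd : c < d by near: c; apply: nbhs_right_lt.
have ce : c <= e ^+ 2 / K by near: c; apply: nbhs_right_le; rewrite divr_gt0// exprn_gt0.
have xc2 : nsq x <= c.
  rewrite -sqr_enorm; apply: (@le_trans _ _ (c ^+ 2)).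
    by rewrite ler_pXn2r ?nnegrE ?enorm_ge0// ltW.
  by rewrite expr2 ler_piMr// ltW.
have := hK x t; rewrite subr0 (flow_fixed0 _ f0) subr0 => h.
rewrite enorm_le_sqr ?(ltW e0)//; apply: (le_trans (h _ tT)); first lra.
by rewrite mulrC -ler_pdivlMr//; lra.
Unshelve. all: by end_near. Qed.

End Flow.

Section FlowFamily.
Variables (R : realType) (n M : nat) (f : 'I_M -> 'rV[R]_n -> 'rV[R]_n).
Variable Phi : 'I_M -> R -> 'rV[R]_n -> 'rV[R]_n.
Hypothesis f_lip : forall i, locally_lipschitz (f i).
Hypothesis f_0 : forall i, f i 0 = 0.
Hypothesis f_flow : forall i, is_flow (f i) (Phi i).

(** Over a bounded time the flows amplify the norm by at most one function of
    class K-infinity: boundedness is the compactness of balls, and smallness at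
    0 holds because 0 is an equilibrium of every mode. *)
Lemma flow_growth T : 0 <= T -> exists g,
  [/\ class_Kinfty g, forall r, 0 <= r -> r <= g r &
   forall i t x, 0 <= t <= T -> enorm (Phi i t x) <= g (enorm x)].
Proof.
move=> T0; pose P v y := exists i t x,
  [/\ 0 <= t <= T, v = enorm x & y = enorm (Phi i t x)].
have [r|e e0|g [Kg gid gP]] := @Kinfty_majorant R P.
- have : \forall B \near +oo, forall i x t, nsq x <= r ^+ 2 -> 0 <= t <= T ->
      nsq (Phi i t x) <= B.
    by apply: filter_forall => i; exact: (flow_bounded (f_lip i) (f_flow i)).
  move=> /filter_ex[B hB]; exists (Num.sqrt B) => v y /andP[_ xr] [i [t [x [tT vE ->]]]].
  rewrite vE in xr; apply: ler_wsqrtr; apply: (hB i x t) => //.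
  by rewrite -enorm_le_sqr//; apply: le_trans xr; exact: enorm_ge0.
- have : \forall d \near 0^'+, 0 < d /\ forall i x t, enorm x <= d -> 0 <= t <= T ->
      enorm (Phi i t x) <= e.
    near=> d; split; first by near: d; exact: nbhs_right_gt.
    near: d; by apply: filter_forall => i; exact: (flow_small (f_lip i) (f_flow i)).
  move=> /filter_ex[d [d0 hd]]; exists d => // v y /andP[_ xr] [i [t [x [tT vE ->]]]].
  by rewrite vE in xr; apply: hd.
- exists g; split=> // i t x tT; apply: gP; first exact: enorm_ge0.
  by exists i, t, x.
Unshelve. all: by end_near. Qed.

End FlowFamily.

(** * Signals and schedules *)

Section Signals.
Variables (R : realType) (M : nat).
Implicit Types (sigma : R -> 'I_M) (q : nat -> 'I_M * R) (t s : R) (k : nat).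

Lemma discrete_continuousP sigma t :
  {for t, continuous (sigma : R -> discrete_topology 'I_M)} <->
  \forall s \near t, sigma s = sigma t.
Proof.
split=> [c|h].
  by apply: (c [set i | i = sigma t]); rewrite nbhs_principalE; exact/principal_filterP.
move=> U; rewrite /= nbhs_principalE => /principal_filterP Ut.
by apply: filterS h => s /= ->.
Qed.

Lemma right_continuous_signalP sigma t :
  (sigma s : discrete_topology 'I_M) @[s --> t^'+]
    --> (sigma t : discrete_topology 'I_M) <->
  \forall s \near t^'+, sigma s = sigma t.
Proof.
split=> [c|h].
  by apply: (c [set i | i = sigma t]); rewrite nbhs_principalE; exact/principal_filterP.
move=> U; rewrite /= nbhs_principalE => /principal_filterP Ut.
by apply: filterS h => s /= ->.
Qed.

(** Signals with infinitely many switching instants are handled through their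
    schedule [q], where [q k] is the mode of the [k]-th stay together with its
    duration. *)
Definition switch_time q k : R := \sum_(j < k) (q j).2.

Lemma switch_time0 q : switch_time q 0 = 0.
Proof. by rewrite /switch_time big_ord0. Qed.

Lemma switch_timeS q k : switch_time q k.+1 = switch_time q k + (q k).2.
Proof. by rewrite /switch_time big_ord_recr. Qed.

Definition schedule q := [/\ forall k, 0 < (q k).2,
  forall A, exists k, A < switch_time q k & forall k, (q k).1 != (q k.+1).1].

Definition follows sigma q :=
  forall k s, switch_time q k <= s < switch_time q k.+1 -> sigma s = (q k).1.

Section Schedule.
Variable q : nat -> 'I_M * R.
Hypothesis sq : schedule q.

Lemma switch_time_lt k : switch_time q k < switch_time q k.+1.
Proof. by case: sq => + _ _; rewrite switch_timeS ltrDl. Qed.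

Lemma switch_time_homo k l : (k <= l)%N -> switch_time q k <= switch_time q l.
Proof.
move=> kl; apply: (homo_leq (@lexx _ _) le_trans _ kl) => i.
exact/ltW/switch_time_lt.
Qed.

Lemma switch_time_ge0 k : 0 <= switch_time q k.
Proof. by rewrite -(switch_time0 q) switch_time_homo. Qed.

Lemma switch_time_cover s : 0 <= s -> exists k, switch_time q k <= s < switch_time q k.+1.
Proof.
move=> s0; have [_ /(_ s) ex _] := sq.
case: (ex_minnP ex) => -[|k]; first by rewrite switch_time0 ltNge s0.
move=> sk hmin; exists k; rewrite sk andbT leNgt; apply/negP => /hmin.
by rewrite ltnn.
Qed.

Lemma switch_time_cover_unique k l s : switch_time q k <= s < switch_time q k.+1 ->
  switch_time q l <= s < switch_time q l.+1 -> k = l.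
Proof.
wlog kl : k l / (k <= l)%N.
  by case/orP: (leq_total k l) => kl h hk hl; [|apply/esym]; exact: (h _ _ kl).
move=> /andP[_ sk] /andP[ls _]; apply/eqP; rewrite eqn_leq kl/= leqNgt.
by apply/negP => /switch_time_homo lk; move: (lt_le_trans sk lk); rewrite ltNge ls.
Qed.

Lemma follows_near sigma k s : follows sigma q ->
  switch_time q k < s < switch_time q k.+1 -> \forall r \near s, sigma r = (q k).1.
Proof.
move=> fq /andP[ks sk]; near=> r; apply: fq; apply/andP; split.
  by apply: ltW; near: r; exact: lt_nbhsr.
by near: r; exact: lt_nbhsl.
Unshelve. all: by end_near. Qed.

Lemma follows_right sigma k s : follows sigma q ->
  switch_time q k <= s < switch_time q k.+1 -> \forall r \near s^'+, sigma r = (q k).1.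
Proof.
move=> fq /andP[ks sk]; near=> r; apply: fq; apply/andP; split.
  by apply: (le_trans ks); near: r; exact: nbhs_right_ge.
by near: r; exact: nbhs_right_lt.
Unshelve. all: by end_near. Qed.

Lemma follows_left sigma k s : follows sigma q ->
  switch_time q k < s <= switch_time q k.+1 -> \forall r \near s^'-, sigma r = (q k).1.
Proof.
move=> fq /andP[ks sk]; near=> r; apply: fq; apply/andP; split.
  by near: r; exact: nbhs_left_ge.
by apply: lt_le_trans sk; near: r; exact: nbhs_left_lt.
Unshelve. all: by end_near. Qed.

(** Consecutive modes differ, so that no stay boundary is invisible in the
    signal. *)
Lemma follows_switching sigma : follows sigma q ->
  range (fun k => switch_time q k.+1) = switching_instant sigma.
Proof.
move=> fq; have sE k : sigma (switch_time q k) = (q k).1.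
  by apply: fq; rewrite lexx switch_time_lt.
apply/seteqP; split=> [_ [k _ <-]|t [t0 nct]].
  split; first by rewrite (le_lt_trans (switch_time_ge0 k)) ?switch_time_lt.
  move=> /discrete_continuousP; rewrite sE => h.
  have h1 : \forall r \near (switch_time q k.+1)^'-, sigma r = (q k.+1).1.
    exact: cvg_within.
  have h2 : \forall r \near (switch_time q k.+1)^'-, sigma r = (q k).1.
    by apply: follows_left; rewrite ?switch_time_lt ?lexx.
  have [r [r1 r2]] := @filter_ex _ (at_left (switch_time q k.+1)) _ _ (filterI h1 h2).
  have [_ _ /(_ k)] := sq; by rewrite -r1 -r2 eqxx.
have [k /andP[kt tk]] := switch_time_cover (ltW t0).
move: (kt); rewrite le_eqVlt => /orP[/eqP kE|kt'].
  case: k kE kt tk => [|k] kE _ _; last by exists k.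
  by move: t0; rewrite -kE switch_time0 ltxx.
case: nct; apply/discrete_continuousP.
have -> : sigma t = (q k).1 by apply: fq; rewrite kt.
by apply: follows_near; rewrite ?kt'.
Qed.

Lemma follows_not_switching sigma k s : follows sigma q ->
  switch_time q k < s < switch_time q k.+1 -> ~ switching_instant sigma s.
Proof.
move=> fq /andP[ks sk] [s0]; apply; apply/discrete_continuousP.
by rewrite (fq k) ?(ltW ks)//; apply: follows_near; rewrite ?ks.
Qed.

Lemma follows_switching_signal sigma : follows sigma q ->
  switching_signals sigma.
Proof.
move=> fq; split=> [T T0|t t0]; last first.
  have [k kt] := switch_time_cover t0; apply/right_continuous_signalP.
  by rewrite (fq k t kt); exact: follows_right.
have ex : exists k, T <= switch_time q k.+1.
  have [_ /(_ T)[[|k] hk] _] := sq; last by exists k; exact: ltW.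
  by move: hk; rewrite switch_time0 => hk; exists 0%N; have := switch_time_ge0 1; lra.
case: (ex_minnP ex) => N TN hmin.
pose S := rcons (mkseq (fun k => switch_time q k.+1) N) T.
have sizeS : size S = N.+1 by rewrite size_rcons size_mkseq.
have nthS k : (k <= N)%N -> nth 0 (0 :: S) k = switch_time q k.
  case: k => [|k] kN; first by rewrite switch_time0.
  by rewrite /= nth_rcons size_mkseq kN nth_mkseq.
have nthSS k : (k <= N)%N -> nth 0 S k <= switch_time q k.+1.
  rewrite leq_eqVlt => /orP[/eqP ->|kN]; last by have := nthS _ kN; rewrite /= => ->.
  by rewrite nth_rcons size_mkseq ltnn eqxx.
have ltT : switch_time q N < T.
  case: N hmin {S TN sizeS nthS nthSS} => [|N] hmin; first by rewrite switch_time0.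
  by rewrite ltNge; apply/negP => /hmin; rewrite ltnn.
exists S.
  split; last by rewrite last_rcons.
  apply/(pathP 0) => k; rewrite sizeS ltnS => kN; rewrite nthS//.
  move: kN; rewrite leq_eqVlt => /orP[/eqP ->|kN].
    by rewrite nth_rcons size_mkseq ltnn eqxx.
  by have := nthS _ kN; rewrite /= => ->; exact: switch_time_lt.
move=> k; rewrite sizeS ltnS => kN; exists (q k).1 => t /andP[kt tk].
apply: fq; rewrite nthS// in kt; rewrite (ltW kt)/=.
by rewrite /= in tk; apply: lt_le_trans tk (nthSS k kN).
Qed.

Lemma follows_enumerates sigma : follows sigma q ->
  enumerates_switching sigma (switch_time q).
Proof.
move=> fq; split; [exact: switch_time0 | exact: switch_time_lt | exact: follows_switching].
Qed.

(** Negative times fall back on stage 0; a trajectory glued stage by stage is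
    thus left-continuous at time 0 as well. *)
Definition stage s : nat :=
  xget 0%N [set k | switch_time q k <= s < switch_time q k.+1].

Lemma stageE k s : switch_time q k <= s < switch_time q k.+1 -> stage s = k.
Proof.
move=> ks.
have := @xgetPex _ 0%N [set j | switch_time q j <= s < switch_time q j.+1].
by move=> /(_ (ex_intro _ k ks)) ks'; exact: switch_time_cover_unique ks' ks.
Qed.

Lemma stage_neg s : s < 0 -> stage s = 0%N.
Proof.
move=> s0; apply: xgetPN => k /andP[ks _].
by have := switch_time_ge0 k; lra.
Qed.

Lemma exists_follows : exists sigma, follows sigma q.
Proof. by exists (fun s => (q (stage s)).1) => k s /stageE ->. Qed.

End Schedule.

(** A signal that is right-continuous at [a] and continuous on [`]a, b[] cannot
    change its value before [b]: at the infimum of the times where it differs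
    from [sigma a] it would be discontinuous. *)
Lemma signal_constant sigma a b :
  (\forall s \near a^'+, sigma s = sigma a) ->
  (forall t, a < t < b -> \forall s \near t, sigma s = sigma t) ->
  forall s, a <= s < b -> sigma s = sigma a.
Proof.
move=> ra ct s /andP[as_ sb]; apply: contrapT => ns.
pose A := [set r | a <= r <= s /\ sigma r <> sigma a].
have infA : has_inf A.
  by split; [exists s; split=> //; rewrite as_ lexx | exists a => r [/andP[ar _] _]].
set m := inf A.
have ma : a <= m by apply: lb_le_inf; [case: infA | move=> r [/andP[ar _] _]].
have ms : m <= s by apply: (ge_inf infA.2); split=> //; rewrite as_ lexx.
have [mE|mN] := pselect (sigma m = sigma a).
  have rm : \forall r \near m^'+, sigma r = sigma a.
    move: ma; rewrite le_eqVlt => /orP[/eqP <-//|am].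
    rewrite -mE; apply: cvg_within; apply: ct; rewrite am/=; exact: le_lt_trans sb.
  have [d /= d0 hd] := rm.
  have [r Ar rd] := inf_adherent d0 infA.
  have mr : m <= r by apply: (ge_inf infA.2).
  move: mr; rewrite le_eqVlt => /orP[/eqP mr|mr].
    by case: Ar => _; rewrite -mr.
  case: Ar => _; apply; apply: hd => //.
  by rewrite /ball_/= ltr0_norm ?subr_lt0//; rewrite -/m in rd; lra.
have am : a < m by rewrite lt_neqAle ma andbT; apply/eqP => am; apply: mN; rewrite am.
have lm : \forall r \near m^'-, sigma r = sigma m.
  by apply: cvg_within; apply: ct; rewrite am/=; exact: le_lt_trans sb.
have ga : \forall r \near m^'-, a <= r by exact: nbhs_left_ge.
have lt : \forall r \near m^'-, r < m by exact: nbhs_left_lt.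
have [r [rE [ra' rm]]] :=
  @filter_ex _ (at_left m) _ _ (filterI lm (filterI ga lt)).
suff : m <= r by rewrite leNgt rm.
by apply: (ge_inf infA.2); split; rewrite ?rE// ra'/= (le_trans (ltW rm)).
Qed.

Lemma piecewise_constant_finite_switching sigma T : piecewise_constant sigma ->
  0 < T -> exists S : seq R, forall t, t < T -> switching_instant sigma t -> t \in S.
Proof.
move=> pc T0; have [S [pS lS] hS] := pc T T0; exists S => t tT [t0 nct].
apply: contrapT => /negP tS; apply: nct; apply/discrete_continuousP.
pose P k := (k < size S)%N && (t < nth 0 S k).
have S0 : (0 < size S)%N.
  by case: S lS {pS hS tS P} => //= /eqP T0'; rewrite -T0' ltxx in T0.
have exP : exists k, P k.
  exists (size S).-1; rewrite /P prednK// leqnn/=.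
  by rewrite nth_last; move/eqP: lS => ->.
case: (ex_minnP exP) => k /andP[kS tk] hmin.
have kt : nth 0 (0 :: S) k < t.
  case: k kS tk hmin => [|k] kS tk hmin; first by [].
  rewrite /= lt_neqAle; apply/andP; split.
    by apply: contraNneq tS => <-; rewrite mem_nth// ltnW.
  rewrite leNgt; apply/negP => tk'; have := hmin k; rewrite /P tk' ltnW// => /(_ isT).
  by rewrite ltnn.
have [i hi] := hS k kS.
rewrite (hi t); last by rewrite kt.
near=> s; apply: hi; apply/andP; split.
  by near: s; exact: lt_nbhsr.
by near: s; exact: lt_nbhsl.
Unshelve. all: by end_near. Qed.

(** The stays exhaust the half-line because a piecewise constant signal has
    finitely many switching instants before any given time. *)
Lemma enumerates_follows sigma (t : nat -> R) :
  switching_signals sigma -> enumerates_switching sigma t ->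
  exists q, [/\ schedule q, follows sigma q & forall k, switch_time q k = t k].
Proof.
move=> [pc rc] [t0 tS tE]; pose q k := (sigma (t k), t k.+1 - t k).
have sE k : switch_time q k = t k.
  by elim: k => [|k IH]; rewrite ?switch_time0 ?t0// switch_timeS IH /= addrC subrK.
have t_homo k l : (k <= l)%N -> t k <= t l.
  by move=> kl; apply: (homo_leq (@lexx _ _) le_trans _ kl) => i; exact/ltW/tS.
have tge0 k : 0 <= t k by rewrite -t0 t_homo.
have tmono k l : (k < l)%N -> t k < t l.
  by move=> kl; apply: (lt_le_trans (tS k)); exact: t_homo.
have noswitch k s : t k < s < t k.+1 -> ~ switching_instant sigma s.
  move=> /andP[ks sk]; rewrite -tE => -[l _ lE].
  have [lk|kl] := leqP l.+1 k.
    by have := t_homo _ _ lk; rewrite lE leNgt ks.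
  by have := t_homo _ _ kl; rewrite lE leNgt sk.
have cts k s : t k < s < t k.+1 -> \forall r \near s, sigma r = sigma s.
  move=> ks; apply/discrete_continuousP; apply: contrapT => nc.
  apply: (noswitch k s ks); split=> //.
  by case/andP: ks => + _; apply: le_lt_trans.
have fq : follows sigma q.
  move=> k s; rewrite !sE => ks; apply: (signal_constant _ (cts k)) => //.
  by apply/right_continuous_signalP; exact: rc.
exists q; split=> //; split.
- by move=> k /=; rewrite subr_gt0.
- move=> A; apply: contrapT => /forallNP hA.
  have T0 : 0 < `|A| + 1 by rewrite ltr_wpDl.
  have [S hS] := piecewise_constant_finite_switching pc T0.
  have sub : {subset mkseq (fun k => t k.+1) (size S).+1 <= S}.
    move=> _ /mapP[k _ ->]; apply: hS; last by rewrite -tE; exists k.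
    have := hA k.+1; rewrite sE => /negP; rewrite -leNgt => h.
    by rewrite (le_lt_trans h)// (le_lt_trans (ler_norm _))// ltrDl.
  have un : uniq (mkseq (fun k => t k.+1) (size S).+1).
    rewrite map_inj_uniq ?iota_uniq// => k l /= kl; apply/eqP.
    rewrite eqn_leq leqNgt [(l <= k)%N]leqNgt; apply/andP; split; apply/negP => h.
      by have := tmono l.+1 k.+1 h; rewrite kl ltxx.
    by have := tmono k.+1 l.+1 h; rewrite kl ltxx.
  have := uniq_leq_size un sub; by rewrite size_mkseq ltnn.
- move=> k /=; apply/negP => /eqP sk.
  have : switching_instant sigma (t k.+1) by rewrite -tE; exists k.
  move=> [_]; apply; apply/discrete_continuousP.
  have h l s : t l <= s < t l.+1 -> sigma s = sigma (t l).
    by have := fq l s; rewrite !sE.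
  near=> s.
  have s1 : t k <= s by apply: ltW; near: s; exact: lt_nbhsr.
  have s2 : s < t k.+2 by near: s; exact: lt_nbhsl.
  have [sk1|ks1] := ltP s (t k.+1); first by rewrite (h k)// s1.
  by rewrite (h k.+1)// ks1.
Unshelve. all: by end_near. Qed.

End Signals.

(** * The switched flow along a schedule *)

Section SwitchedFlow.
Variables (R : realType) (n M : nat) (f : 'I_M -> 'rV[R]_n -> 'rV[R]_n).
Variable Phi : 'I_M -> R -> 'rV[R]_n -> 'rV[R]_n.
Hypothesis f_lip : forall i, locally_lipschitz (f i).
Hypothesis f_flow : forall i, is_flow (f i) (Phi i).
Implicit Types (q : nat -> 'I_M * R) (x y : 'rV[R]_n) (k : nat) (s t : R).

Fixpoint state q k x :=
  if k is k'.+1 then Phi (q k').1 (q k').2 (state q k' x) else x.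

(** The switched flow is selected by choice among all solutions. Gluing the flows
    of the successive modes shows that there is a solution, and uniqueness on
    each stay shows that the selected one is the glued one. *)
Section Formula.
Variables (q : nat -> 'I_M * R) (sigma : R -> 'I_M) (x : 'rV[R]_n).
Hypotheses (sq : schedule q) (fq : follows sigma q).

Let piece k s := Phi (q k).1 (s - switch_time q k) (state q k x).

Let piece_derive k s : is_derive s 1 (piece k) (f (q k).1 (piece k s)).
Proof. exact: (is_derive1_shift (flow_derive (f_flow _) _ _)). Qed.

Let piece_continuous k : continuous (piece k).
Proof. by move=> s; exact: is_derive1_continuous (piece_derive k s). Qed.

Let piece_glue k : piece k.+1 (switch_time q k.+1) = piece k (switch_time q k.+1).
Proof.
by rewrite /piece subrr (flow0 (f_flow _))/= switch_timeS addrAC subrr add0r.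
Qed.

Let traj s := piece (stage q s) s.

Let trajE k s : switch_time q k <= s < switch_time q k.+1 -> traj s = piece k s.
Proof. by move=> ks; rewrite /traj (stageE sq ks). Qed.

Let traj_neg s : s < 0 -> traj s = piece 0 s.
Proof. by move=> s0; rewrite /traj (stage_neg sq s0). Qed.

Let traj_continuous s : 0 <= s -> {for s, continuous traj}.
Proof.
move=> s0; have [k ks] := switch_time_cover sq s0.
have [ks1 sk1] := andP ks.
apply/left_right_continuousP; rewrite (trajE ks); split; last first.
  have c : piece k @ s^'+ --> piece k s.
    by apply: cvg_within_filter; exact: piece_continuous.
  apply: cvg_trans c; apply: near_eq_cvg; near=> r; rewrite (@trajE k)//.
  apply/andP; split.
    by apply: (le_trans ks1); near: r; exact: nbhs_right_ge.
  by near: r; exact: nbhs_right_lt.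
have left l : {near s^'-, piece l =1 traj} -> piece l s = piece k s ->
    traj @ s^'- --> piece k s.
  move=> ne <-; have c : piece l @ s^'- --> piece l s.
    by apply: cvg_within_filter; exact: piece_continuous.
  exact: cvg_trans (near_eq_cvg ne) c.
move: (ks1); rewrite le_eqVlt => /orP[/eqP kE|ks'].
  case: k kE {ks1 sk1} ks left => [|k] kE ks left.
    apply: (left 0%N) => //; near=> r; rewrite traj_neg//.
    have : r < s by near: r; exact: nbhs_left_lt.
    by rewrite -kE switch_time0.
  apply: (left k); last by rewrite -kE piece_glue.
  near=> r; rewrite (@trajE k)//; apply/andP; split.
    near: r; apply: nbhs_left_ge; rewrite -kE; exact: switch_time_lt.
  by rewrite kE; near: r; exact: nbhs_left_lt.
apply: (left k) => //; near=> r; rewrite (@trajE k)//; apply/andP; split.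
  by near: r; exact: nbhs_left_ge.
by apply: lt_trans sk1; near: r; exact: nbhs_left_lt.
Unshelve. all: by end_near. Qed.

Let traj_solution : is_switched_solution f sigma x traj.
Proof.
split.
- rewrite (@trajE 0%N) ?switch_time0 ?lexx/=; last by rewrite -(switch_time0 q) switch_time_lt.
  by rewrite /piece switch_time0 subrr (flow0 (f_flow _)).
- apply: continuous_in_subspaceT => s; rewrite inE/= in_itv/= andbT.
  exact: traj_continuous.
- move=> t t0 nt; have [k kt] := switch_time_cover sq (ltW t0).
  have ks : switch_time q k < t.
    case/andP: (kt) => + _; rewrite le_eqVlt => /orP[/eqP kE|//].
    case: k kE {kt} => [|k] kE; first by rewrite -kE switch_time0 ltxx in t0.
    by case: nt; rewrite -(follows_switching sq fq); exists k.
  rewrite (trajE kt) (fq kt); apply: near_eq_is_derive (piece_derive k t).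
  have [_ tk] := andP kt; near=> r; rewrite (@trajE k)//; apply/andP; split.
    by apply: ltW; near: r; exact: lt_nbhsr.
  by near: r; exact: lt_nbhsl.
Unshelve. all: by end_near. Qed.

Lemma switched_flowE k s : switch_time q k <= s <= switch_time q k.+1 ->
  switched_flow f sigma s x = Phi (q k).1 (s - switch_time q k) (state q k x).
Proof.
pose u s := switched_flow f sigma s x.
have [u0 cu du] : is_switched_solution f sigma x u.
  have := @xgetPex _ (cst x) (is_switched_solution f sigma x).
  by apply; exists traj; exact: traj_solution.
have step l : u (switch_time q l) = state q l x ->
    forall s, switch_time q l <= s <= switch_time q l.+1 -> u s = piece l s.
  move=> ul r lr; rewrite /piece -ul.
  apply: (flow_unique_within (f_lip (q l).1) (f_flow _) _ _ lr).
    apply: continuous_subspaceW cu => z /=; rewrite !in_itv/= andbT => /andP[+ _].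
    by apply: le_trans; exact: switch_time_ge0.
  move=> t lt; have tq : sigma t = (q l).1.
    by apply: fq; case/andP: lt => /ltW -> ->.
  rewrite -tq; apply: du; last exact: follows_not_switching lt.
  by case/andP: lt => + _; apply: le_lt_trans; exact: switch_time_ge0.
have ul l : u (switch_time q l) = state q l x.
  elim: l => [|l IH]; first by rewrite switch_time0.
  rewrite (step l IH) ?lexx ?(ltW (switch_time_lt sq _))//.
  by rewrite /piece switch_timeS addrAC subrr add0r.
exact: (step k (ul k)).
Qed.

End Formula.
End SwitchedFlow.

(** * From Lyapunov functions to stability *)

Section Sufficiency.
Variable R : realType.

(** All that is needed of the inverse of [a] is an upper bound of class
    K-infinity. *)
Lemma Kinfty_inverse_majorant (a : R -> R) : class_Kinfty a ->
  exists g, class_Kinfty g /\ forall y, 0 <= y -> y <= g (a y).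
Proof.
move=> [Ka ainf]; pose P v y := 0 <= y /\ a y <= v.
have ltK y z : 0 <= z -> a y < a z -> y < z.
  by move=> z0; rewrite !ltNge; apply: contra => zy; apply: (class_K_homo Ka).
have [r|e e0|g [Kg _ gP]] := @Kinfty_majorant R P.
- have [A A0 rA] := ainf r; exists A => v y /andP[_ vr] [y0 av].
  by apply/ltW/ltK => //; apply: le_lt_trans rA; exact: le_trans vr.
- have ae := class_K_gt0 Ka e0; exists (a e / 2); first lra.
  by move=> v y /andP[_ vr] [y0 av]; apply/ltW/ltK; lra.
- exists g; split=> // y y0; apply: gP; first exact: class_K_ge0.
  by split.
Qed.

Lemma class_KL_of_exponential (kap mu : R -> R) (c : R) :
  class_K kap -> class_K mu -> exists2 b, class_KL b &
    forall r t, 0 <= r -> b r t = kap (expR (c - t) * mu r).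
Proof.
move=> Kk Km.
pose b r t := kap (Num.max 0 (expR (c - t) * mu (Num.max 0 r))).
have m0 r : 0 <= mu (Num.max 0 r) by rewrite (class_K_ge0 Km)// le_max lexx.
have em r t : 0 <= expR (c - t) * mu (Num.max 0 r) by rewrite mulr_ge0 ?expR_ge0.
have bE r t : b r t = kap (expR (c - t) * mu (Num.max 0 r)).
  by rewrite /b max_r.
exists b => [|r t r0]; last by rewrite bE max_r.
have ce : continuous (fun t : R => expR (c - t)).
  move=> t; apply: (@continuous_comp _ _ _ (fun t : R => c - t) expR).
    by apply: cvgB; [exact: cvg_cst | exact: cvg_id].
  exact: continuous_expR.
split.
- apply: continuous_subspaceT => p.
  apply: (@continuous_comp _ _ _
    (fun p : R * R => expR (c - p.2) * mu (Num.max 0 p.1))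
    (fun z => kap (Num.max 0 z))); last exact: class_K_ext_continuous.
  apply: cvgM.
    by apply: (@continuous_comp _ _ _ snd (fun t : R => expR (c - t)));
      [exact: cvg_snd | exact: ce].
  by apply: (@continuous_comp _ _ _ fst (fun r : R => mu (Num.max 0 r)));
    [exact: cvg_fst | exact: class_K_ext_continuous].
- by move=> r s _ _; rewrite bE (class_K_ge0 Kk).
- move=> t t0; apply: class_K_of_continuous.
  + move=> r; apply: (@continuous_comp _ _ _
      (fun r : R => expR (c - t) * mu (Num.max 0 r)) (fun z => kap (Num.max 0 z)));
      last exact: class_K_ext_continuous.
    by apply: cvgM; [exact: cvg_cst | exact: class_K_ext_continuous].
  + move=> r s r0 rs; have [_ kinc _] := Kk; have [_ minc _] := Km.
    rewrite !bE; apply: kinc => //; rewrite ltr_pM2l ?expR_gt0// !max_r//; last lra.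
    exact: minc.
  + by rewrite bE maxxx; have [_ _ ->] := Km; rewrite mulr0; have [_ _ ->] := Kk.
- move=> r s t r0 s0 st; rewrite !bE; apply: (class_K_homo Kk) => //.
  by rewrite ler_wpM2r// ler_expR; lra.
- move=> r r0; apply/cvgrPdist_le => e e0; have [d d0 hd] := class_K_small Kk e0.
  near=> t; rewrite sub0r normrN bE ger0_norm ?(class_K_ge0 Kk)//.
  apply: hd; rewrite em/=.
  have t1 : c + mu (Num.max 0 r) / d <= t by near: t; apply: nbhs_pinfty_ge; exact: num_real.
  have h : (t - c) * expR (c - t) <= 1.
    have := expR_ge1Dx (t - c); rewrite -(opprB t c) expRN => h.
    by rewrite ler_pdivrMr ?expR_gt0// mul1r; lra.
  have : mu (Num.max 0 r) <= (t - c) * d by rewrite -ler_pdivrMr//; lra.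
  have := expR_gt0 (c - t); move: (expR _) h => E; nra.
Unshelve. all: by end_near. Qed.

End Sufficiency.

Section SufficiencySwitched.
Variables (R : realType) (n M : nat) (f : 'I_M -> 'rV[R]_n -> 'rV[R]_n).
Variable Phi : 'I_M -> R -> 'rV[R]_n -> 'rV[R]_n.
Variables tau1 tau2 : R.
Hypothesis f_lip : forall i, locally_lipschitz (f i).
Hypothesis f_0 : forall i, f i 0 = 0.
Hypothesis f_flow : forall i, is_flow (f i) (Phi i).
Hypotheses (tau1_ge0 : 0 <= tau1) (tau12 : tau1 <= tau2).
Variables (alpha1 alpha2 : R -> R) (Wm Wp : 'I_M -> 'rV[R]_n -> R).
Hypotheses (Ka1 : class_Kinfty alpha1) (Ka2 : class_Kinfty alpha2).
Hypothesis Wm_bound : forall i x, alpha1 (enorm x) <= Wm i x <= alpha2 (enorm x).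
Hypothesis Wp_decr : forall i x, Wp i (Phi i tau1 x) <= expR (- tau1) * Wm i x.
Hypothesis Wm_decr : forall i j, i != j -> forall t, 0 <= t <= tau2 - tau1 ->
  forall x, Wm j (Phi i t x) <= expR (- t) * Wp i x.

(** A stay of duration [d] splits into [tau1], where the first decrease condition
    applies, and [d - tau1], where the second one does. *)
Lemma lyapunov_dwell i j d x : i != j -> tau1 <= d <= tau2 ->
  Wm j (Phi i d x) <= expR (- d) * Wm i x.
Proof.
move=> ij /andP[d1 d2]; have -> : d = (d - tau1) + tau1 by rewrite subrK.
rewrite (flow_add (f_flow i)); set z := Phi i tau1 x.
apply: (le_trans (Wm_decr ij _ z)); first by rewrite subr_ge0 d1 lerD2r.
have -> : expR (- (d - tau1 + tau1)) = expR (- (d - tau1)) * expR (- tau1).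
  by rewrite -expRD -opprD.
rewrite -mulrA ler_pM2l ?expR_gt0//; exact: Wp_decr.
Qed.

(** Read at the switching instants and in the mode being entered, [Wm] decays
    exponentially from the first switching instant on. The first stay, which may
    be shorter than [tau1], and the time since the last switching instant are
    both bounded by [tau2] and are controlled by [flow_growth]. *)
Lemma lyapunov_GUAS : GUAS f (S_dw_star tau1 tau2).
Proof.
have tau2_ge0 : 0 <= tau2 by exact: le_trans tau12.
have [g [Kg gid gP]] := flow_growth f_lip f_0 f_flow tau2_ge0.
have [eta [Keta etaP]] := Kinfty_inverse_majorant Ka1.
have Kk := class_K_comp Kg.1 Keta.1; have Km := class_K_comp Ka2.1 Kg.1.
(* One factor [e ^ tau2] pays for the first stay, the other one for the time
   since the last switching instant. *)
have [b KLb bE] := class_KL_of_exponential (2 * tau2) Kk Km.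
exists b => // sigma [ss [t et [t1 td]]] x s s0; rewrite bE ?enorm_ge0//.
have [q [sq fq stE]] := enumerates_follows ss et.
have [k ks] := switch_time_cover sq s0.
rewrite (switched_flowE f_lip f_flow x sq fq (k := k)); last first.
  by case/andP: ks => -> /ltW ->.
case/andP: ks => ks /ltW sk; set mu := (alpha2 \o g) (enorm x).
have mu0 : 0 <= mu by exact: class_K_ge0 Km (enorm_ge0 x).
have dE l : (q l).2 = t l.+1 - t l by rewrite -!stE switch_timeS addrAC subrr add0r.
have d0 : 0 <= (q 0%N).2 by apply/ltW; case: sq => + _ _; apply.
have dS l : tau1 <= (q l.+1).2 <= tau2 by rewrite dE td.
have d1 : (q 0%N).2 <= tau2 by rewrite dE; case: et => -> _ _; rewrite subr0.
have d2 l : (q l).2 <= tau2 by case: l => [//|l]; case/andP: (dS l).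
have bnd y : alpha2 (enorm y) <= mu -> forall i, Wm i y <= mu.
  by move=> ymu i; case/andP: (Wm_bound i y) => _; move/le_trans; apply.
have growth i r y : 0 <= r <= tau2 -> alpha2 (enorm (Phi i r y)) <= (alpha2 \o g) (enorm y).
  by move=> r0; apply: (class_K_homo Ka2.1 (enorm_ge0 _)); exact: gP.
have decay l : Wm (q l.+1).1 (state Phi q l.+1 x) <= expR (tau2 - switch_time q l.+1) * mu.
  elim: l => [|l IH].
    rewrite switch_timeS switch_time0 add0r; apply: (@le_trans _ _ mu).
      by apply: bnd; apply: growth; rewrite d0.
    by rewrite ler_peMl// -[leLHS](@expR0 R) ler_expR subr_ge0.
  rewrite [state _ _ _ _]/=; set y := state _ _ _ _ in IH *.
  have qq : (q l.+1).1 != (q l.+2).1 by case: sq.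
  apply: (le_trans (lyapunov_dwell y qq (dS l))).
  rewrite (switch_timeS q l.+1) opprD addrA addrC expRD -mulrA ler_pM2l ?expR_gt0//.
have final y : Wm (q k).1 y <= expR (2 * tau2 - s) * mu ->
    enorm y <= eta (expR (2 * tau2 - s) * mu).
  move=> Wy; apply: (le_trans (etaP _ (enorm_ge0 y))).
  apply: (class_K_homo Keta.1); first exact: class_K_ge0 Ka1.1 (enorm_ge0 y).
  by apply: le_trans Wy; case/andP: (Wm_bound (q k).1 y).
have kap_ge0 : 0 <= eta (expR (2 * tau2 - s) * mu).
  by apply: (class_K_ge0 Keta.1); rewrite mulr_ge0 ?expR_ge0.
have sk' : s - switch_time q k <= tau2.
  by apply: le_trans (d2 k); rewrite switch_timeS in sk; lra.
case: k ks sk final sk' => [|k] ks sk final sk'.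
  apply: le_trans (gid _ kap_ge0); apply: final.
  rewrite switch_time0 subr0 in sk' *; apply: (@le_trans _ _ mu).
    by apply: bnd; apply: growth; rewrite s0.
  by rewrite ler_peMl// -[leLHS](@expR0 R) ler_expR; lra.
apply: (@le_trans _ _ (g (enorm (state Phi q k.+1 x)))).
  by apply: gP; rewrite subr_ge0 ks.
apply: (class_K_homo Kg.1 (enorm_ge0 _)); apply: final.
apply: (le_trans (decay k)); rewrite ler_wpM2r// ler_expR; lra.
Qed.

End SufficiencySwitched.

(** * Finite words of modes *)

Section Words.
Variables (R : realType) (n M : nat) (f : 'I_M -> 'rV[R]_n -> 'rV[R]_n).
Variable Phi : 'I_M -> R -> 'rV[R]_n -> 'rV[R]_n.
Variables tau1 tau2 : R.
Hypothesis f_lip : forall i, locally_lipschitz (f i).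
Hypothesis f_flow : forall i, is_flow (f i) (Phi i).
Hypotheses (tau1_ge0 : 0 <= tau1) (tau12 : tau1 <= tau2) (tau2_gt0 : 0 < tau2).
Local Notation word := (seq ('I_M * R)).
Implicit Types (w : word) (x y : 'rV[R]_n) (i j : 'I_M).

Definition run w x := foldl (fun y p => Phi p.1 p.2 y) x w.

Definition dur w : R := \sum_(p <- w) p.2.

(** What may follow a completed stay in mode [i]. The last stay of a word may be
    interrupted at any time, hence its duration has no lower bound. *)
Fixpoint admissible_after i w : bool :=
  if w is (j, d) :: w' then
    [&& j != i, 0 <= d <= tau2, (w' == [::]) || (tau1 <= d) & admissible_after j w']
  else true.

(** The first stay of a word has no lower bound either, as in signals observed
    from an arbitrary initial time. *)
Definition admissible w : bool :=
  if w is (i, d) :: w' then (0 <= d <= tau2) && admissible_after i w' else false.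

Lemma admissible_after_rcons_prefix i w p : admissible_after i (rcons w p) -> admissible_after i w.
Proof.
elim: w i => [//|[j d] w IH] i /= /and4P[-> -> + /IH ->].
by rewrite andbT; case: w {IH}.
Qed.

Lemma admissible_after_rcons_shorten i w j d s : 0 <= s <= d ->
  admissible_after i (rcons w (j, d)) -> admissible_after i (rcons w (j, s)).
Proof.
move=> /andP[s0 sd]; elim: w i => [|[j' d'] w IH] i /=.
  by move=> /andP[-> /andP[/andP[_ dt] _]]; rewrite s0 (le_trans sd dt).
by move=> /and4P[-> -> + /IH ->]; rewrite andbT; case: w {IH}.
Qed.

Lemma admissible_rcons_prefix w p : admissible (rcons w p) -> w = [::] \/ admissible w.
Proof.
case: w => [|[i d] w] /=; first by left.
by move=> /andP[-> /admissible_after_rcons_prefix ->]; right.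
Qed.

Lemma admissible_rcons_shorten w j d s : 0 <= s <= d ->
  admissible (rcons w (j, d)) -> admissible (rcons w (j, s)).
Proof.
move=> sd; case: w => [|[i d'] w] /=.
  by case/andP: (sd) => -> sd' /andP[/andP[_ dt] _]; rewrite (le_trans sd' dt).
by move=> /andP[-> /(admissible_after_rcons_shorten sd) ->].
Qed.

Lemma dur_ge0 w : admissible w -> 0 <= dur w.
Proof.
case: w => [//|[i d] w] /= /andP[/andP[d0 _] lw]; rewrite /dur big_cons addr_ge0//=.
elim: w i lw {d d0} => [|[j d] w IH] i; first by rewrite big_nil.
by move=> /and4P[_ /andP[d0 _] _ /IH h]; rewrite big_cons addr_ge0.
Qed.

Lemma run_rcons w p x : run (rcons w p) x = Phi p.1 p.2 (run w x).
Proof. by rewrite /run foldl_rcons. Qed.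

Lemma dur_rcons w p : dur (rcons w p) = dur w + p.2.
Proof. by rewrite /dur -cats1 big_cat big_seq1. Qed.

Lemma run_mkseq q N x : run (mkseq q N) x = state Phi q N x.
Proof. by elim: N => [//|N IH]; rewrite mkseqS run_rcons IH. Qed.

Lemma dur_mkseq q N : dur (mkseq q N) = switch_time q N.
Proof.
elim: N => [|N IH]; first by rewrite switch_time0 /dur big_nil.
by rewrite mkseqS dur_rcons IH switch_timeS.
Qed.

Section Extension.
Hypothesis other : forall i, exists j, j != i.

Definition scons T (a : T) (q : nat -> T) k := if k is k'.+1 then q k' else a.

Lemma mkseq_scons T (a : T) q N : mkseq (scons a q) N.+1 = a :: mkseq q N.
Proof. by rewrite /mkseq /= (iotaDl 1 0) -map_comp. Qed.

(** The last, possibly interrupted, stay is prolonged to its maximal length,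
    after which two modes alternate at the slowest allowed pace. *)
Lemma word_extension i d w : 0 < d <= tau2 -> admissible_after i w ->
  all (fun p => 0 < p.2) w -> exists q N s,
  [/\ q 0%N = (i, if w is [::] then tau2 else d),
      forall k, (q k).1 != (q k.+1).1,
      forall k, 0 < (q k).2 <= tau2 /\ tau1 <= (q k.+1).2,
      exists K, forall k, (K <= k)%N -> (q k).2 = tau2
    & (i, d) :: w = rcons (mkseq q N) ((q N).1, s) /\ 0 <= s <= (q N).2].
Proof.
elim: w i d => [|[j d'] w IH] i d /andP[d0 dt].
  move=> _ _; have [j ji] := other i.
  exists (fun k => (if odd k then j else i, tau2)), 0%N, d; split=> //.
  - by move=> k /=; case: (odd k) => //=; rewrite eq_sym.
  - by move=> k /=; rewrite tau2_gt0 lexx.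
  - by exists 0%N.
  - by split=> //=; rewrite dt ltW.
move=> /and4P[ji /andP[_ d't] wd lw] /= /andP[d'0 pw].
have d't' : 0 < d' <= tau2 by rewrite d'0.
have [q [N [s [q0 qN qd [K hK] [wE sE]]]]] := IH j d' d't' lw pw.
exists (scons (i, d) q), N.+1, s; split=> //.
- by case=> [|k] //=; rewrite q0 eq_sym.
- case=> [|k] /=; last by case: (qd k) => -> _; have [_] := qd k.
  by rewrite d0 dt q0; split=> //=; case: w wd {IH lw pw q0 wE} => //=.
- by exists K.+1 => -[//|k] Kk; exact: hK.
- by rewrite mkseq_scons wE.
Qed.

Variable b : R -> R -> R.
Hypothesis KLb : class_KL b.
Hypothesis guas : forall sigma, S_dw_star tau1 tau2 sigma ->
  forall x t, 0 <= t -> enorm (switched_flow f sigma t x) <= b (enorm x) t.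

Lemma positive_word_bound w x : admissible w -> all (fun p => 0 < p.2) w ->
  enorm (run w x) <= b (enorm x) (dur w).
Proof.
case: w => [//|[i d] w] /= /andP[/andP[_ dt] lw] /andP[d0 pw].
have d0t : 0 < d <= tau2 by rewrite d0.
have [q [N [s [_ qN qd [K hK] [wE /andP[s0 sd]]]]]] := word_extension d0t lw pw.
have unb A : exists k, A < switch_time q k.
  have lb m : m%:R * tau2 <= switch_time q (K + m).
    elim: m => [|m IH]; last first.
      by rewrite addnS switch_timeS hK ?leq_addr// -natr1 mulrDl mul1r lerD2r.
    rewrite mul0r; apply: sumr_ge0 => k _.
    by case: (qd k) => /andP[/ltW].
  exists (K + (Num.Def.archi_bound `|A / tau2|%R))%N; apply: lt_le_trans (lb _).
  rewrite -ltr_pdivrMr//; apply: le_lt_trans (ler_norm _) _.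
  by apply: archi_boundP; exact: normr_ge0.
have sq : schedule q by split=> // k; case: (qd k) => /andP[].
have [sigma fq] := exists_follows sq.
have Ss : S_dw_star tau1 tau2 sigma.
  split; first exact: follows_switching_signal fq.
  exists (switch_time q); first exact: follows_enumerates.
  split; first by rewrite switch_timeS switch_time0 add0r; case: (qd 0%N) => /andP[].
  move=> k; rewrite (switch_timeS q k.+1) addrAC subrr add0r.
  by case: (qd k) => _ ->; case: (qd k.+1) => /andP[].
have := guas Ss x (t := switch_time q N + s) _.
rewrite (switched_flowE f_lip f_flow x sq fq (k := N)); last first.
  by rewrite lerDl s0 switch_timeS lerD2l sd.
rewrite -[run w _]/(run ((i, d) :: w) x) wE.
rewrite run_rcons dur_rcons run_mkseq dur_mkseq /= addrAC subrr add0r; apply.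
by rewrite addr_ge0// (switch_time_ge0 sq).
Qed.

(** When [tau1] is 0, words may contain stays of zero duration, which signals do
    not have. Padding makes all stays positive. *)
Definition pad (e : R) w := [seq (p.1, Num.max p.2 e) | p <- w].

Lemma admissible_pad e w : 0 < e <= tau2 -> admissible w ->
  admissible (pad e w) /\ all (fun p => 0 < p.2) (pad e w).
Proof.
move=> /andP[e0 et].
have lp i w' : admissible_after i w' -> admissible_after i (pad e w').
  elim: w' i => [//|[j d] w' IH] i /= /and4P[-> /andP[d0 dt] wd /IH ->].
  rewrite le_max d0 ge_max dt et/= andbT; case: w' wd {IH} => //= _ _ h.
  by rewrite le_max h.
case: w => [//|[i d] w] /= /andP[/andP[d0 dt] lw].
rewrite le_max d0 ge_max dt et/= lp// lt_max e0 orbT/=; split=> //.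
by rewrite all_map; apply/allP => p _ /=; rewrite lt_max e0 orbT.
Qed.

Lemma dur_pad e w : dur w <= dur (pad e w).
Proof.
by rewrite /dur big_map; apply: ler_sum => p _ /=; rewrite le_max lexx.
Qed.

Lemma run_pad_cvg w (Y : R -> 'rV[R]_n) y : all (fun p => 0 <= p.2) w ->
  Y @ 0^'+ --> y -> (fun e => run (pad e w) (Y e)) @ 0^'+ --> run w y.
Proof.
elim: w Y y => [//|[i d] w IH] Y y /= /andP[d0 pw] cY.
apply: (IH (fun e => Phi i (Num.max d e) (Y e))) => //.
apply: (flow_cvg (f_lip i) (f_flow i)) => //.
  by move=> e; rewrite le_max d0.
rewrite -[X in _ --> X](max_l d0); apply: cvg_at_right_filter.
 apply: continuous_max; first exact: cvg_cst.
exact: cvg_id.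
Qed.

(** Positive words are initial parts of signals; the others are limits of padded
    ones, and padding only lengthens a word whereas [b] decreases in time. *)
Lemma word_bound w x : admissible w -> enorm (run w x) <= b (enorm x) (dur w).
Proof.
move=> sw; have [_ _ _ bdecr _] := KLb.
have pw : all (fun p => 0 <= p.2) w.
  case: w sw => [//|[i d] w] /= /andP[/andP[-> _] /=].
  by elim: w i => [//|[j d'] w IH] i /= /and4P[_ /andP[-> _] _ /IH ->].
have cr : (fun e => run (pad e w) x) @ 0^'+ --> run w x.
  by apply: run_pad_cvg => //; exact: cvg_cst.
have ce : (fun e => enorm (run (pad e w) x)) @ 0^'+ --> enorm (run w x).
  apply: (@cvg_comp _ _ _ (fun e => run (pad e w) x) (@enorm R n)) cr _.
  exact: enorm_continuous.
apply: (cvgr_to_le ce).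
near=> e; have et : 0 < e <= tau2.
  by apply/andP; split; near: e; [exact: nbhs_right_gt | exact: nbhs_right_le].
have [sp pp] := admissible_pad et sw; apply: (le_trans (positive_word_bound x sp pp)).
by apply: bdecr; [exact: enorm_ge0 | exact: dur_ge0 | exact: dur_pad].
Unshelve. all: by end_near. Qed.

End Extension.

(** Every interrupted word is admissible, so the whole trajectory remains in the
    ball where the fields are Lipschitz, and Gronwall's inequality applies to
    each stay with the same constant. *)
Lemma word_lipschitz B C x y :
  (forall i u v, nsq u <= B -> nsq v <= B ->
     nsq (f i u - f i v) <= C * nsq (u - v)) ->
  (forall w, admissible w -> nsq (run w x) <= B /\ nsq (run w y) <= B) ->
  forall w, admissible w ->
    nsq (run w x - run w y) <= expR ((1 + C) * dur w) * nsq (x - y).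
Proof.
move=> lip bd; have h w : w = [::] \/ admissible w ->
    nsq (run w x - run w y) <= expR ((1 + C) * dur w) * nsq (x - y).
  elim/last_ind: w => [_|w [j d] IH].
    by rewrite /dur big_nil mulr0 expR0 mul1r.
  move=> [e|sw]; first by move: (congr1 size e); rewrite size_rcons.
  have {}IH := IH (admissible_rcons_prefix sw).
  have d0 : 0 <= d.
    case: w sw {IH} => [|[i d'] w] /=; first by case/andP => /andP[].
    case/andP => _; elim: w i {d'} => [|[i' d'] w IH] i /=.
      by case/andP => _ /andP[/andP[]].
    by case/and4P => _ _ _; exact: IH.
  rewrite !run_rcons dur_rcons/=.
  have cP z : {within `[0, d], continuous (Phi j ^~ z)}.
    by apply: continuous_subspaceT => t; exact: (flow_continuous_time (f_flow j)).
  have := gronwall_nsq (cP (run w x)) (cP (run w y))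
    (fun t _ => flow_derive (f_flow j) (run w x) t)
    (fun t _ => flow_derive (f_flow j) (run w y) t) (C := C).
  have lipw t : 0 < t < d -> nsq (f j (Phi j t (run w x)) - f j (Phi j t (run w y))) <=
      C * nsq (Phi j t (run w x) - Phi j t (run w y)).
    move=> /andP[t0 td]; have st : admissible (rcons w (j, t)).
      by apply: admissible_rcons_shorten sw; rewrite !ltW.
    by have [] := bd _ st; rewrite !run_rcons; exact: lip.
  move=> /(_ lipw d); rewrite d0 lexx => /(_ isT); rewrite !(flow0 (f_flow j)) subr0.
  move=> g; apply: (le_trans g).
  have -> : expR ((1 + C) * (dur w + d)) =
      expR ((1 + C) * d) * expR ((1 + C) * dur w).
    by rewrite -expRD -mulrDr (addrC d).
  by rewrite -mulrA ler_wpM2l ?expR_ge0//; exact: IH.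
by move=> w sw; apply: h; right.
Qed.

End Words.

(** * From stability to Lyapunov functions *)

Section Necessity.
Variables (R : realType) (n M : nat) (f : 'I_M -> 'rV[R]_n -> 'rV[R]_n).
Variable Phi : 'I_M -> R -> 'rV[R]_n -> 'rV[R]_n.
Variables tau1 tau2 : R.
Hypothesis f_lip : forall i, locally_lipschitz (f i).
Hypothesis f_flow : forall i, is_flow (f i) (Phi i).
Hypotheses (tau1_ge0 : 0 <= tau1) (tau12 : tau1 <= tau2) (tau2_gt0 : 0 < tau2).
Hypothesis other : forall i : 'I_M, exists j, j != i.
Local Notation word := (seq ('I_M * R)).
Local Notation admissible := (admissible tau1 tau2).
Local Notation admissible_after := (admissible_after tau1 tau2).
Local Notation run := (run Phi).
Implicit Types (w : word) (x y z : 'rV[R]_n) (i j : 'I_M).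

Lemma locally_lipschitz_ball_family r : exists2 C, 0 <= C &
  forall i y z, nsq y <= r -> nsq z <= r -> nsq (f i y - f i z) <= C * nsq (y - z).
Proof.
have ex i : exists C, 0 <= C /\ forall y z, nsq y <= r -> nsq z <= r ->
    nsq (f i y - f i z) <= C * nsq (y - z).
  by have [C C0 hC] := locally_lipschitz_ball r (f_lip i); exists C.
have [C hC] := choice ex.
exists (\sum_i C i); first by apply: sumr_ge0 => i _; case: (hC i).
move=> i y z yr zr; apply: (le_trans ((hC i).2 y z yr zr)).
rewrite ler_wpM2r ?nsq_ge0// (bigD1 i)//= lerDl.
by apply: sumr_ge0 => j _; case: (hC j).
Qed.

(** Distances are measured by [nsq], the quantity that [word_lipschitz]
    controls. *)
Lemma uniformly_continuous_ball (h : 'rV[R]_n -> R) (B e : R) :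
  continuous h -> 0 < e -> exists2 d, 0 < d & forall y z,
    nsq y <= B -> nsq (y - z) < d -> `|h y - h z| <= e.
Proof.
move=> ch e0; have /compact_near_coveringP := @compact_nsq_ball R n B.
pose P (d : R) y := forall z, nsq (y - z) < d -> `|h y - h z| <= e.
have cover x : [set x | nsq x <= B] x -> \forall y \near x & d \near 0^'+, P d y.
  move=> _; have /cvgrPdist_lt := ch x.
  move=> /(_ (e / 2) (divr_gt0 e0 (ltr0n _ 2))) hx.
  have /nbhs_ballP[r /= r0 hr] : nbhs x [set y | `|h x - h y| < e / 2] by [].
  have hr' z : nsq (x - z) < r ^+ 2 -> `|h x - h z| < e / 2.
    move=> xz; apply: hr; rewrite -ball_normE /ball_/=.
    by rewrite -(ltr_pXn2r (n := 2)) ?nnegrE ?(ltW r0)// (le_lt_trans (sqr_norm_le_nsq _)).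
  have r20 : 0 < r ^+ 2 by rewrite exprn_gt0.
  exists ([set y | nsq (y - x) < r ^+ 2 / 4], [set d | d < r ^+ 2 / 4]).
    split=> /=; last by apply: nbhs_right_lt; lra.
    by apply: (cvgr_lt _ (nsq_sub_cvg0 x)); lra.
  move=> [y d] [/= yx dr] z yz.
  have h1 : `|h x - h y| < e / 2 by apply: hr'; rewrite nsq_sub; lra.
  have h2 : `|h x - h z| < e / 2.
    apply: hr'; rewrite nsq_sub.
    have := nsq_split (y - x) (z - x).
    have -> : z - x - (y - x) = z - y by rewrite opprB addrA subrK.
    by rewrite (nsq_sub z y); lra.
  rewrite -(subrKA (h x)) (le_trans (ler_normD _ _))// distrC; lra.
move=> /(_ _ (at_right 0) P _ cover) H.
have [d [d0 hd]] := @filter_ex _ (at_right (0 : R)) _ _ (filterI (nbhs_right_gt 0) H).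
by exists d => // y z yB; exact: hd.
Qed.

Variable b : R -> R -> R.
Hypothesis KLb : class_KL b.
Hypothesis guas : forall sigma, S_dw_star tau1 tau2 sigma ->
  forall x t, 0 <= t -> enorm (switched_flow f sigma t x) <= b (enorm x) t.
Variables a a2 : R -> R.
Hypotheses (Ka : class_Kinfty a) (Ka2 : class_Kinfty a2).
Hypothesis ab : forall r t, 0 <= r -> 0 <= t -> expR (2 * t) * a (b r t) <= a2 r.

(** With the factor [e ^ t], prolonging a word to the left by a time [t]
    multiplies its weight by [e ^ t], which produces the decrease conditions. *)
Definition weight w x := expR (dur w) * a (enorm (run w x)).

Let bound w x : admissible w -> enorm (run w x) <= b (enorm x) (dur w).
Proof. exact: (word_bound f_lip f_flow tau12 tau2_gt0 other KLb guas). Qed.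

Lemma weight_ge0 w x : 0 <= weight w x.
Proof. by rewrite mulr_ge0 ?expR_ge0// (class_K_ge0 Ka.1)// enorm_ge0. Qed.

(** The gauge decays at rate 2 while the weight grows at rate 1. *)
Lemma weight_tail w x : admissible w -> weight w x <= expR (- dur w) * a2 (enorm x).
Proof.
move=> sw; have := ab (enorm_ge0 x) (dur_ge0 sw).
have := class_K_homo Ka.1 (enorm_ge0 _) (bound x sw).
rewrite /weight; have -> : expR (2 * dur w) = expR (dur w) * expR (dur w).
  by rewrite -expRD; congr expR; lra.
rewrite expRN; have := expR_gt0 (dur w); move: (expR _) => E E0 h1 h2.
rewrite ler_pdivlMl// mulrA; apply: le_trans h2.
by rewrite ler_wpM2l// mulr_ge0// ltW.
Qed.

Lemma weight_le w x : admissible w -> weight w x <= a2 (enorm x).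
Proof.
move=> sw; apply: (le_trans (weight_tail x sw)).
rewrite ler_piMl ?(class_K_ge0 Ka2.1) ?enorm_ge0// expR_le1.
by rewrite oppr_le0 (dur_ge0 sw).
Qed.

(** Uniform equicontinuity: long words contribute little by [weight_tail], and
    short ones depend on the initial point in a uniformly Lipschitz way. *)
Lemma weight_equicontinuous x e : 0 < e ->
  \forall y \near x, forall w, admissible w -> `|weight w x - weight w y| <= e.
Proof.
move=> e0; pose r := enorm x + 1; have r0 : 0 <= r by rewrite addr_ge0 ?enorm_ge0.
have [_ bge0 bK bdecr _] := KLb.
have bd y w : enorm y <= r -> admissible w -> nsq (run w y) <= b r 0 ^+ 2.
  move=> yr sw; rewrite -enorm_le_sqr ?bge0//.
  apply: (le_trans (bound y sw)); apply: (@le_trans _ _ (b (enorm y) 0)).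
    by rewrite bdecr ?enorm_ge0 ?dur_ge0 ?(dur_ge0 sw).
  by apply: (class_K_homo (bK 0 (lexx _))); rewrite ?enorm_ge0.
have [C C0 hC] := locally_lipschitz_ball_family (b r 0 ^+ 2).
(* [e ^ (- T) * a2 r <= e] follows from [1 + T <= e ^ T]. *)
pose T := a2 r / e; have a2r : 0 <= a2 r by exact: class_K_ge0 Ka2.1 r0.
have T0 : 0 <= T by rewrite divr_ge0// ltW.
have Te : expR (- T) * a2 r <= e.
  rewrite expRN ler_pdivrMl ?expR_gt0//.
  have := expR_ge1Dx T; have : a2 r = T * e by rewrite /T mulfVK// gt_eqF.
  by move: (expR T) => E -> ?; rewrite ler_wpM2r ?(ltW e0)//; lra.
have ch : continuous (a \o @enorm R n).
  have -> : a \o @enorm R n = (fun s : R => a (Num.max 0 s)) \o @enorm R n.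
    by apply/funext => y /=; rewrite max_r// enorm_ge0.
  move=> y; apply: (@continuous_comp _ _ _ (@enorm R n) (fun s : R => a (Num.max 0 s))).
    exact: enorm_continuous.
  exact: (class_K_ext_continuous Ka.1).
have [|d d0 hd] := uniformly_continuous_ball (b r 0 ^+ 2) (e := e / expR T) ch.
  by rewrite divr_gt0// expR_gt0.
near=> y.
have yr : enorm y <= r.
  near: y; apply: (cvgr_le _ (@enorm_continuous R n x)); rewrite /r; lra.
have xr : enorm x <= r by rewrite /r; lra.
have xy : nsq (y - x) < d / expR ((1 + C) * T).
  near: y.
  by apply: (cvgr_lt _ (nsq_sub_cvg0 x)); rewrite divr_gt0// expR_gt0.
move=> w sw; have [wT|Tw] := leP (dur w) T.
  rewrite /weight -mulrBr normrM ger0_norm ?expR_ge0//.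
  apply: (@le_trans _ _ (expR T * (e / expR T))); last first.
    by rewrite mulrCA mulfV ?mulr1// gt_eqF// expR_gt0.
  apply: ler_pM; rewrite ?expR_ge0 ?ler_expR//.
  apply: hd; first exact: bd.
  have := word_lipschitz f_flow hC (fun v sv => conj (bd x v xr sv) (bd y v yr sv)) sw.
  move=> /le_lt_trans; apply.
  apply: (@le_lt_trans _ _ (expR ((1 + C) * T) * nsq (x - y))).
    by rewrite ler_wpM2r ?nsq_ge0// ler_expR ler_wpM2l// addr_ge0.
  by rewrite nsq_sub mulrC -ltr_pdivlMr ?expR_gt0.
have tail z : enorm z <= r -> weight w z <= e.
  move=> zr; apply: (le_trans (weight_tail z sw)); apply: (le_trans _ Te).
  apply: ler_pM; rewrite ?expR_ge0 ?(class_K_ge0 Ka2.1) ?enorm_ge0//.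
    by rewrite ler_expR lerN2 ltW.
  by apply: (class_K_homo Ka2.1); rewrite ?enorm_ge0.
have := tail x xr; have := tail y yr; have := weight_ge0 w x; have := weight_ge0 w y.
by move=> *; rewrite ler_norml; lra.
Unshelve. all: by end_near. Qed.

Definition value (A : set word) x := sup [set weight w x | w in A].

Section Value.
Variable A : set word.
Hypotheses (A0 : A !=set0) (A_adm : A `<=` admissible).

Lemma has_sup_weight x : has_sup [set weight w x | w in A].
Proof.
split; first by case: A0 => w Aw; exists (weight w x), w.
by exists (a2 (enorm x)) => _ [w Aw <-]; exact: weight_le (A_adm Aw).
Qed.

Lemma value_ge w x : A w -> weight w x <= value A x.
Proof. by move=> Aw; apply: (ub_le_sup (has_sup_weight x).2); exists w. Qed.

Lemma value_le x c : (forall w, A w -> weight w x <= c) -> value A x <= c.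
Proof.
move=> h; apply: ge_sup; first exact: (has_sup_weight x).1.
by move=> _ [w Aw <-]; exact: h.
Qed.

Lemma value_continuous : continuous (value A).
Proof.
move=> x; apply/(@cvgrPdist_le _ _ _ (nbhs x)) => e e0.
apply: filterS (weight_equicontinuous x e0) => y hy.
have h1 : value A x <= value A y + e.
  apply: value_le => w Aw; have := hy w (A_adm Aw); rewrite ler_norml.
  by have := value_ge y Aw; lra.
have h2 : value A y <= value A x + e.
  apply: value_le => w Aw; have := hy w (A_adm Aw); rewrite ler_norml.
  by have := value_ge x Aw; lra.
by rewrite ler_norml; lra.
Qed.

Lemma value_bounds i x : A [:: (i, 0)] ->
  a (enorm x) <= value A x <= a2 (enorm x).
Proof.
move=> Ai; apply/andP; split.
  apply: le_trans (value_ge x Ai).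
  by rewrite /weight /dur big_seq1 expR0 mul1r /run/= (flow0 (f_flow i)).
by apply: value_le => w Aw; exact: weight_le (A_adm Aw).
Qed.

End Value.

(** The continuations of a signal that has just switched to mode [i]. *)
Definition entering i : set word := [set w |
  if w is (j, d) :: w' then
    [&& j == i, 0 <= d <= tau2, (w' == [::]) || (tau1 <= d) & admissible_after i w']
  else false].

(** The continuations of a signal that has already spent [tau1] in mode [i]. *)
Definition dwelled i : set word := [set w |
  if w is (j, d) :: w' then
    [&& j == i, 0 <= d <= tau2 - tau1 & admissible_after i w']
  else false].

Lemma entering_admissible i : entering i `<=` admissible.
Proof.
move=> [//|[j d] w] /and4P[/eqP -> dt _ lw] /=.
by apply/andP; split.
Qed.

Lemma dwelled_admissible i : dwelled i `<=` admissible.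
Proof.
move=> [//|[j d] w] /and3P[/eqP -> /andP[d0 dt] lw].
by apply/andP; split=> //; rewrite d0/= (le_trans dt)// gerBl.
Qed.

Lemma entering0 i : entering i [:: (i, 0)].
Proof. by rewrite /entering/= eqxx lexx/= andbT ltW. Qed.

Lemma dwelled0 i : dwelled i [:: (i, 0)].
Proof. by rewrite /dwelled/= eqxx lexx/= andbT subr_ge0. Qed.

(** Both decrease conditions express that prolonging a word to the left keeps it
    in the relevant set: a word of [dwelled i] becomes one of [entering i] when
    its first stay is lengthened by [tau1], and a word of [entering j] becomes
    one of [dwelled i] when a stay of duration [t] in mode [i] is put in front. *)
Lemma lyapunov_converse : exists (Wm Wp : 'I_M -> 'rV[R]_n -> R),
  [/\ forall i, continuous (Wm i) /\ continuous (Wp i),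
      forall i x, a (enorm x) <= Wm i x <= a2 (enorm x) /\
                  a (enorm x) <= Wp i x <= a2 (enorm x),
      forall i x, Wp i (Phi i tau1 x) <= expR (- tau1) * Wm i x
    & forall i j, i != j -> forall t : R, 0 <= t <= tau2 - tau1 ->
        forall x, Wm j (Phi i t x) <= expR (- t) * Wp i x].
Proof.
have en0 i : entering i !=set0 by exists [:: (i, 0)]; exact: entering0.
have dn0 i : dwelled i !=set0 by exists [:: (i, 0)]; exact: dwelled0.
exists (fun i => value (entering i)), (fun i => value (dwelled i)); split.
- by move=> i; split; apply: value_continuous => //;
    [exact: entering_admissible | exact: dwelled_admissible].
- move=> i x; split.
    by apply: (value_bounds (en0 i) (@entering_admissible i)); exact: entering0.
  by apply: (value_bounds (dn0 i) (@dwelled_admissible i)); exact: dwelled0.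
- move=> i x; apply: (value_le (dn0 i) (@dwelled_admissible i)) => -[//|[j d] w].
  move=> /and3P[/eqP -> /andP[d0 dt] lw].
  have Av : entering i ((i, d + tau1) :: w).
    apply/and4P; split=> //; last by rewrite lerDr d0 orbT.
    by rewrite addr_ge0//= -lerBrDr.
  have := value_ge (en0 i) (@entering_admissible i) x Av.
  rewrite /weight /dur !big_cons /run/= (flow_add (f_flow i)).
  have -> : d + tau1 + \sum_(p <- w) p.2 = tau1 + (d + \sum_(p <- w) p.2) by lra.
  by rewrite expRN (expRD tau1) -mulrA ler_pdivlMl// expR_gt0.
- move=> i j ij t t12 x; apply: (value_le (en0 j) (@entering_admissible j)) => -[//|[k d] w].
  move=> /and4P[/eqP -> dt wd lw].
  have Av : dwelled i ((i, t) :: (j, d) :: w).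
    by rewrite /dwelled/= eqxx t12 eq_sym ij dt wd lw.
  have := value_ge (dn0 i) (@dwelled_admissible i) x Av.
  rewrite /weight /dur !big_cons /run/=.
  by rewrite expRN (expRD t) -mulrA ler_pdivlMl// expR_gt0.
Qed.

End Necessity.

(** * Absence of switching, and the equivalence *)

Section Degenerate.
Variables (R : realType) (n M : nat) (f : 'I_M -> 'rV[R]_n -> 'rV[R]_n).
Variable Phi : 'I_M -> R -> 'rV[R]_n -> 'rV[R]_n.
Hypothesis f_flow : forall i, is_flow (f i) (Phi i).

Lemma class_Kinfty_id : class_Kinfty (fun r : R => r).
Proof.
split; first by apply: class_K_of_continuous => // x; exact: cvg_id.
move=> A; exists (`|A| + 1); first by rewrite addr_ge0.
by rewrite (le_lt_trans (ler_norm _))// ltrDl.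
Qed.

Lemma class_Kinfty_scale (a : R -> R) c : 1 <= c -> class_Kinfty a ->
  class_Kinfty (fun r => c * a r).
Proof.
move=> c1 [Ka ainf]; have c0 : 0 < c by exact: lt_le_trans c1.
have Kc : class_K (fun r : R => c * r).
  apply: class_K_of_continuous; last by rewrite mulr0.
    by move=> x; apply: cvgM; [exact: cvg_cst | exact: cvg_id].
  by move=> r s _ rs; rewrite ltr_pM2l.
split; first exact: class_K_comp Kc Ka.
move=> A; have [r r0 Ar] := ainf A; exists r => //; apply: (lt_le_trans Ar).
by rewrite ler_peMl// class_K_ge0.
Qed.

(** With a single mode the condition relating distinct modes is void, and
    [flow_growth] up to time [tau] gives the remaining one. *)
Lemma lyapunov_single_mode tau : (forall i, locally_lipschitz (f i)) ->
  (forall i, f i 0 = 0) -> 0 <= tau ->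
  exists (a1 a2 : R -> R) (Wm Wp : 'I_M -> 'rV[R]_n -> R),
  [/\ class_Kinfty a1 /\ class_Kinfty a2,
      forall i, continuous (Wm i) /\ continuous (Wp i),
      forall i x, a1 (enorm x) <= Wm i x <= a2 (enorm x) /\
                  a1 (enorm x) <= Wp i x <= a2 (enorm x)
    & forall i x, Wp i (Phi i tau x) <= expR (- tau) * Wm i x].
Proof.
move=> f_lip f_0 tau0.
have [g [Kg gid gP]] := flow_growth f_lip f_0 f_flow tau0.
have e1 : 1 <= expR tau by rewrite -[leLHS](@expR0 R) ler_expR.
have Ka2 := class_Kinfty_scale e1 Kg.
have le2 x : enorm x <= expR tau * g (enorm x).
  apply: (le_trans (gid _ (enorm_ge0 x))).
  by rewrite ler_peMl// (class_K_ge0 Kg.1)// enorm_ge0.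
exists (fun r => r), (fun r => expR tau * g r),
  (fun _ x => expR tau * g (enorm x)), (fun _ => @enorm R n); split.
- by split=> //; exact: class_Kinfty_id.
- move=> i; split; last exact: enorm_continuous.
  have -> : (fun x => expR tau * g (enorm x)) =
      (fun s : R => expR tau * g (Num.max 0 s)) \o @enorm R n.
    by apply/funext => x /=; rewrite max_r// enorm_ge0.
  move=> x; apply: (@continuous_comp _ _ _ (@enorm R n)
    (fun s : R => expR tau * g (Num.max 0 s))); first exact: enorm_continuous.
  by apply: cvgM; [exact: cvg_cst | exact: (class_K_ext_continuous Kg.1)].
- by move=> i x; rewrite !lexx !le2.
- move=> i x; rewrite mulrA -expRD addNr expR0 mul1r.
  by apply: gP; rewrite tau0 lexx.
Qed.

End Degenerate.

Theorem proposition1 (R : realType) (n M : nat)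
    (f : 'I_M -> 'rV[R]_n -> 'rV[R]_n)
    (Phi : 'I_M -> R -> 'rV[R]_n -> 'rV[R]_n)
    (tau1 tau2 : R)
    (f_lip : forall i, locally_lipschitz (f i))
    (f_0 : forall i, f i 0 = 0)
    (f_flow : forall i, is_flow (f i) (Phi i))
    (tau1_ge0 : 0 <= tau1) (tau12 : tau1 <= tau2) :
  (GUAS f (S_dw_star tau1 tau2) <->
   exists (alpha1 alpha2 : R -> R) (Wm Wp : 'I_M -> 'rV[R]_n -> R),
     [/\ class_Kinfty alpha1 /\ class_Kinfty alpha2,
         forall i, continuous (Wm i) /\ continuous (Wp i),
         forall i x,
           alpha1 (enorm x) <= Wm i x <= alpha2 (enorm x) /\
           alpha1 (enorm x) <= Wp i x <= alpha2 (enorm x),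
         forall i x, Wp i (Phi i tau1 x) <= expR (- tau1) * Wm i x
       & forall i j, i != j -> forall t : R, 0 <= t <= tau2 - tau1 ->
           forall x, Wm j (Phi i t x) <= expR (- t) * Wp i x])
  /\ (GUAS f (S_dw_star tau1 tau2) -> GUAS f (S_dw tau1 tau2)).
Proof.
split; last first.
  move=> [b KLb hb]; exists b => // sigma [ss [t et td]].
  apply: hb; split=> //; exists t => //; split=> [|k]; last exact: td.
  by have /andP[_] := td 0%N; case: et => -> _ _; rewrite subr0.
split; last first.
  move=> [a1 [a2 [Wm [Wp [[Ka1 Ka2] _ bd Wp_decr Wm_decr]]]]].
  apply: (lyapunov_GUAS f_lip f_0 f_flow tau1_ge0 tau12 Ka1 Ka2 _ Wp_decr Wm_decr).
  by move=> i x; have [] := bd i x.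
move=> [b KLb hb].
(* Without a second mode there is no switching and stability says nothing. *)
have [single|/existsNP[i0 /existsNP[j0 /eqP ij0]]] :=
    pselect (forall i j : 'I_M, i = j).
  have [a1 [a2 [Wm [Wp [Ka cW bd decr]]]]] :=
    lyapunov_single_mode f_flow f_lip f_0 tau1_ge0.
  exists a1, a2, Wm, Wp; split=> // i j; by rewrite (single i j) eqxx.
(* The same holds if [tau2 = 0]; then all decrease conditions are at time 0. *)
have [tau2_le0|tau2_gt0] := leP tau2 0.
  have t20 : tau2 = 0 by lra.
  have t10 : tau1 = 0 by lra.
  exists (fun r => r), (fun r => r), (fun _ => @enorm R n), (fun _ => @enorm R n).
  split.
  - by split; exact: class_Kinfty_id.
  - by move=> i; split; exact: enorm_continuous.
  - by move=> i x; rewrite !lexx.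
  - by move=> i x; rewrite t10 (flow0 (f_flow i)) oppr0 expR0 mul1r.
  - move=> i j _ t; rewrite t20 t10 subrr => /le_anti <- x.
    by rewrite (flow0 (f_flow i)) oppr0 expR0 mul1r.
have other i : exists j : 'I_M, j != i.
  by have [->|ne] := eqVneq i i0; [exists j0; rewrite eq_sym | exists i0; rewrite eq_sym].
have [a1 [a2 [Ka1 Ka2 ab]]] := class_KL_exponential KLb.
have [Wm [Wp [cW bd Wp_decr Wm_decr]]] :=
  lyapunov_converse f_lip f_flow tau1_ge0 tau12 tau2_gt0 other KLb hb Ka1 Ka2 ab.
by exists a1, a2, Wm, Wp.
Qed.
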